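(* Let $a<b$ be real, $d,D\in\mathbb{N}$, and let $F\in L^2([0,1]^{d+D},\mathbb{R})$, $\mathcal{H}$, $\mathcal{L}$, $\mathcal{L}_n$, $f_{\mathcal{H}}$, $f_{n,\mathcal{H}}$ be as in the deep learning problem with uniform input described in the context. Suppose that $F$ satisfies the boundary growth condition with arbitrarily small $(B_i)_{i=1}^{d+D}$. Suppose that the data sequence $(\boldsymbol{u}_{i})_{i=1}^{\infty}$ is a scrambled $(t,d+D)$-sequence in base $\beta\geq 2$. Let the sample size be $n=\beta^{m}$, $m\in \mathbb{N}$. Then for arbitrarily small $\epsilon>0$ (i.e. for every $\epsilon>0$) we have, as $m\to\infty$, $$\mathbb{E}\left[ \mathcal{L}(f_{n,\mathcal{H}})-\mathcal{L}(f_{\mathcal{H}})\right] = O(n^{-1+\epsilon}).$$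
   Context: **Deep learning problem with uniform input.** Let $a\in\mathbb{R}$, $b\in(a,\infty)$, $d,D\in\mathbb{N}$. Let $U_1$ be uniform on $(0,1)^d$ and $U_2$ uniform on $(0,1)^D$, with $U=(U_1,U_2)$ uniform on $(0,1)^{d+D}$. The input and output are $X=a+(b-a)U_1$ (componentwise) and $Y=F(U)$, where $F\in L^2([0,1]^{d+D},\mathbb{R})$. Let $\boldsymbol{u}_i=(\boldsymbol{u}_{i,1},\boldsymbol{u}_{i,2})$, $i\in\mathbb{N}$, be random variables each with the distribution of $U$ (not necessarily independent), and set $\boldsymbol{x}_i=a+(b-a)\boldsymbol{u}_{i,1}$, $\boldsymbol{y}_i=F(\boldsymbol{u}_i)$. Define the risk and empirical risk $$\mathcal{L}(f)=\mathbb{E}[(f(X)-Y)^2],\qquad \mathcal{L}_n(f)=\frac1n\sum_{i=1}^n[f(\boldsymbol{x}_i)-\boldsymbol{y}_i]^2 .$$ For the random function $f_{n,\mathcal{H}}$ below, $\mathcal{L}(f_{n,\mathcal{H}})$ is the functional $\mathcal{L}$ evaluated at the realization of $f_{n,\mathcal{H}}$; the outer expectation is over the data. **Hypothesis class.** Let $L\ge2$, $S=(N_0,\dots,N_L)=(d,N_1,\dots,N_{L-1},1)\in\mathbb{N}^{L+1}$, $R\in(0,\infty)$ and $\rho(x)=\frac{x}{1+\exp(-x)}$ (swish). For $\theta=((A_l,B_l))_{l=1}^L$ with $A_l\in\mathbb{R}^{N_l\times N_{l-1}}$, $B_l\in\mathbb{R}^{N_l}$, put $W_l(x)=A_lx+B_l$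 and $\Phi_\theta=W_L\circ\rho\circ W_{L-1}\circ\rho\cdots\circ\rho\circ W_1$, with $\rho$ applied componentwise. Let $\Theta_R=\{\theta:\|\theta\|_\infty\le R\}$ and $\mathcal{H}=\{\Phi_\theta|_{[a,b]^d}:\theta\in\Theta_R\}$. The class $\mathcal{H}$ is kept fixed as $n$ varies. Define $f_{\mathcal{H}}=\operatorname{argmin}_{f\in\mathcal{H}}\mathcal{L}(f)$ and $f_{n,\mathcal{H}}=\operatorname{argmin}_{f\in\mathcal{H}}\mathcal{L}_n(f)$. **Boundary growth condition.** For a nonempty $v\subseteq\{1,\dots,s\}$, $D_v g=\left(\prod_{i\in v}\partial/\partial u_i\right)g$, and $D_\emptyset g=g$. A function $g$ on $(0,1)^s$ satisfies the boundary growth condition with constants $(B_i)_{i=1}^s$ if there exists $B\in(0,\infty)$ such that for every $v\subseteq\{1,\dots,s\}$ and $u\in(0,1)^s$, $$|(D_vg)(u)|\le B\prod_{i=1}^s[\min(u_i,1-u_i)]^{-B_i-\mathbf{1}\{i\in v\}}.$$ ''With arbitrarily small $B_i$'' means that for every $\delta>0$ there are $B_1,\dots,B_s\in(0,\delta)$ for which the condition holds ($B$ may depend on them). **Scrambled $(t,s)$-sequences in base $\beta$.** An elementary interval in base $\beta$ is a set $\prod_{j=1}^s[c_j\beta^{-k_j},(c_j+1)\beta^{-k_j})$ with integers $k_j\ge 0$, $0\le c_j<\beta^{k_j}$. A set of $\beta^m$ points in $[0,1)^s$ is a $(t,m,s)$-net (integers $0\le t\le m$) if every elementary interval of volume $\beta^{t-m}$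 contains exactly $\beta^t$ of them. A sequence $(a_i)_{i\ge1}$ in $[0,1)^s$ is a $(t,s)$-sequence if for all integers $k\ge0$, $m\ge t$ the points $a_i$ with $k\beta^m<i\le(k+1)\beta^m$ form a $(t,m,s)$-net. A scrambled $(t,s)$-sequence $(\boldsymbol{u}_i)$ is obtained from a $(t,s)$-sequence by Owen's nested uniform scrambling: if the $j$th coordinate of $a_i$ is $\sum_{k\ge1}a_{i,j,k}\beta^{-k}$, the $j$th coordinate of $\boldsymbol{u}_i$ is $\sum_{k\ge1}x_{i,j,k}\beta^{-k}$ with $x_{i,j,k}=\pi_{j;a_{i,j,1},\dots,a_{i,j,k-1}}(a_{i,j,k})$, all permutations $\pi_{j;\cdot}$ of $\{0,\dots,\beta-1\}$ being mutually independent and uniformly distributed. It has the properties: (i) every $\boldsymbol{u}_i$ is uniform on $(0,1)^s$; (ii) it is a $(t,s)$-sequence in base $\beta$ with probability 1; (iii) there is a constant $B'$ such that for every $m\in\mathbb{N}$ and $n=\beta^m$, with probability 1, the star discrepancy satisfies $D^*(\boldsymbol{u}_1,\dots,\boldsymbol{u}_n)\le B'(\log n)^s/n$. *)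

(* Defs.v *)
From HB Require Import structures.
From mathcomp Require Import all_boot all_order all_algebra all_fingroup.
From mathcomp Require Import all_classical all_reals all_analysis.
From mathcomp Require Import measurable_realfun.

Set Implicit Arguments.
Unset Strict Implicit.
Unset Printing Implicit Defensive.

Import Order.TTheory GRing.Theory Num.Theory.
Import numFieldNormedType.Exports.

Local Open Scope classical_set_scope.
Local Open Scope ring_scope.

(* Points of R^s are [s.-tuple R], which carry the product sigma-algebra. *)

Section UniformCube.
Context {R : realType}.

Section Step.
Context (s : nat) (Q : probability (s.-tuple R) R).

Let prodQ := (uniform_prob (@ltr01 R) \x Q)%E.

HB.instance Definition _ := Measure.on prodQ.

Let prodQ_setT : prodQ setT = 1%E.
Proof.
rewrite -setXTT [LHS]product_measure1E//.
by rewrite -[1%E]mule1; congr (_ * _)%E; exact: probability_setT.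
Qed.

HB.instance Definition _ :=
  Measure_isProbability.Build _ _ _ prodQ prodQ_setT.

(* [uniform_prob] lives on [measurableTypeR R], which has the same measurable
   sets as [R] but is a different [measurableType]. *)
Let cons_pair (p : measurableTypeR R * s.-tuple R) : s.+1.-tuple R :=
  [tuple of (p.1 : R) :: p.2].

Let measurable_cons_pair : measurable_fun setT cons_pair.
Proof.
apply: (@measurable_cons _ _ _ R (fun p => p.1) s (fun p => p.2)).
  exact: (@measurable_fst _ _ (measurableTypeR R) (s.-tuple R)).
exact: measurable_snd.
Qed.

HB.instance Definition _ :=
  isMeasurableFun.Build _ _ _ _ cons_pair measurable_cons_pair.

Definition cons_uniform : probability (s.+1.-tuple R) R :=
  distribution prodQ cons_pair.
End Step.

(* Lebesgue measure on the unit cube of R^s, as a probability on R^s. *)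
Fixpoint cube_prob (s : nat) : probability (s.-tuple R) R :=
  match s with
  | 0 => dirac ([tuple] : 0.-tuple R)
  | s'.+1 => cons_uniform (cube_prob s')
  end.

(* Equality is only asked on measurable sets: [distribution] is a set function
   defined, without meaning, on all sets. *)
Definition uniform_on_cube d (T : measurableType d) (P : probability T R)
    (s : nat) (U : {RV P >-> s.-tuple R}) :=
  forall A, measurable A -> distribution P U A = cube_prob s A.

End UniformCube.

Section BoundaryGrowth.
Context {R : realType} {s : nat}.
Implicit Types (g : s.-tuple R -> R) (u : s.-tuple R) (v : {set 'I_s}).

Definition open_cube : set (s.-tuple R) :=
  [set u | forall j, 0 < tnth u j < 1].

Definition coord_line u (j : 'I_s) (x : R) : s.-tuple R :=
  [tuple if i == j then x else tnth u i | i < s].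

Definition partial (j : 'I_s) g : s.-tuple R -> R :=
  fun u => derive1 (fun x => g (coord_line u j x)) (tnth u j).

(* [enum v] is increasing, so the derivative with respect to the variable of
   largest index is taken first. *)
Definition mixed_partial v g : s.-tuple R -> R := foldr partial g (enum v).

(* Existence, on the open cube, of all the derivatives which occur in the
   iterated definition of the mixed partials. *)
Definition has_mixed_partials g :=
  forall v (j : 'I_s), (forall i, i \in v -> (j < i)%N) ->
  forall u, open_cube u ->
    derivable (fun x => mixed_partial v g (coord_line u j x)) (tnth u j) 1.

Definition boundary_growth g (Bs : 'I_s -> R) :=
  has_mixed_partials g /\
  exists2 B : R, 0 < B & forall v u, open_cube u ->
    `|mixed_partial v g u| <=
      B * \prod_(i < s)
            (Num.min (tnth u i) (1 - tnth u i)) `^ (- Bs i - (i \in v)%:R).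

Definition boundary_growth_arbitrarily_small g :=
  forall delta : R, 0 < delta ->
  exists2 Bs : 'I_s -> R, (forall i, 0 < Bs i < delta) & boundary_growth g Bs.

End BoundaryGrowth.

Section Nets.
Context {R : realType} {s : nat}.

Definition elementary_interval (beta : nat) (k c : 'I_s -> nat) :
    {pred s.-tuple R} :=
  [pred x | [forall j, (c j)%:R / beta%:R ^+ k j <= tnth x j
                         < (c j).+1%:R / beta%:R ^+ k j]].

Definition elementary_volume (beta : nat) (k : 'I_s -> nat) : R :=
  \prod_(j < s) beta%:R ^- k j.

Definition ts_net (beta t m : nat) (p : 'I_(beta ^ m)%N -> s.-tuple R) :=
  [/\ (t <= m)%N,
      forall i j, 0 <= tnth (p i) j < 1 &
      forall k c : 'I_s -> nat, (forall j, (c j < beta ^ k j)%N) ->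
        elementary_volume beta k = beta%:R ^- (m - t) ->
        #|[set i | p i \in elementary_interval beta k c]%SET| = (beta ^ t)%N].

(* Sequences are indexed from 0: [a i] is the (i+1)-st point. *)
Definition ts_sequence (beta t : nat) (a : nat -> s.-tuple R) :=
  forall k m : nat, (t <= m)%N ->
    ts_net t (fun i : 'I_(beta ^ m)%N => a (k * beta ^ m + i)%N).

End Nets.

Section Scrambling.
Context d (T : measurableType d) (R : realType) (P : probability T R).

Definition mutually_independent (I : eqType) (V : finType) (X : I -> T -> V) :=
  forall (J : seq I) (A : I -> set V), uniq J ->
    P (\bigcap_(i in [set` J]) (X i @^-1` A i)) =
    (\prod_(i <- J) P (X i @^-1` A i))%E.

Definition discrete_measurable (V : finType) (X : T -> V) :=
  forall v : V, measurable (X @^-1` [set v]).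

Definition discrete_uniform (V : finType) (X : T -> V) :=
  forall v : V, P (X @^-1` [set v]) = (#|V|%:R^-1)%:E.

Section Digits.
Context (beta : nat) (beta_gt0 : (0 < beta)%N).

(* The digit of [x] of weight beta^-(k+1); for a base-beta rational this is the
   terminating expansion. *)
Definition digit (x : R) (k : nat) : 'I_beta :=
  Ordinal (ltn_pmod (Num.truncn (x * beta%:R ^+ k.+1)) beta_gt0).

Definition scramble_coord (pi : seq 'I_beta -> {perm 'I_beta}) (x : R) : R :=
  limn (series (fun k : nat =>
    (pi [seq digit x l | l <- iota 0 k] (digit x k))%:R / beta%:R ^+ k.+1 : R)).

Definition owen_scrambling (s : nat) (a u : nat -> s.-tuple R)
    (pi : 'I_s -> seq 'I_beta -> {perm 'I_beta}) :=
  forall i j, tnth (u i) j = scramble_coord (pi j) (tnth (a i) j).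

Definition scrambled_ts_sequence (s t : nat) (u : nat -> T -> s.-tuple R) :=
  exists a : nat -> s.-tuple R, ts_sequence beta t a /\
  exists pi : 'I_s -> seq 'I_beta -> T -> {perm 'I_beta},
    [/\ forall j p, discrete_measurable (pi j p),
        forall j p, discrete_uniform (pi j p),
        mutually_independent
          (fun jp : 'I_s * seq 'I_beta => pi jp.1 jp.2) &
        forall w, owen_scrambling a (u ^~ w) (fun j p => pi j p w)].

End Digits.
End Scrambling.

Section Networks.
Context {R : realType}.

Definition swish (x : R) : R := x / (1 + expR (- x)).

(* Parameters ((A_1, B_1), .., (A_L, B_L)) of a network with input dimension
   [din], hidden widths [h] = [:: N_1; ..; N_(L-1)] and scalar output. *)
Fixpoint nn_params (din : nat) (h : seq nat) : Type :=
  match h with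
  | [::] => ('M[R]_(1, din) * 'cV[R]_1)%type
  | n :: h' => (('M[R]_(n, din) * 'cV[R]_n) * nn_params n h')%type
  end.

Definition affine (m n : nat) (AB : 'M[R]_(m, n) * 'cV[R]_m) (x : 'cV[R]_n) :=
  AB.1 *m x + AB.2.

Fixpoint realization (din : nat) (h : seq nat) :
    nn_params din h -> 'cV[R]_din -> R :=
  match h with
  | [::] => fun th x => affine th x 0 0
  | n :: h' => fun th x => realization th.2 (map_mx swish (affine th.1 x))
  end.

Definition layer_norm (m n : nat) (AB : 'M[R]_(m, n) * 'cV[R]_m) : R :=
  Num.max (mx_norm AB.1) (mx_norm AB.2).

Fixpoint nn_norm (din : nat) (h : seq nat) : nn_params din h -> R :=
  match h with
  | [::] => fun th => layer_norm th
  | n :: h' => fun th => Num.max (layer_norm th.1) (nn_norm th.2)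
  end.

Definition box (a b : R) {d : nat} : set (d.-tuple R) :=
  [set x | forall j, a <= tnth x j <= b].

(* Functions on [a,b]^d are represented by their extension by 0. *)
Definition nn_class (a b : R) (d : nat) (h : seq nat) (r : R) :
    set (d.-tuple R -> R) :=
  [set (fun x : d.-tuple R => realization th (\col_j tnth x j)) \_ (box a b)
     | th in [set th : nn_params d h | nn_norm th <= r]].

End Networks.

Arguments nn_class {R} a b d h r.

Section Learning.
Context {R : realType}.

Definition argmin (V : Type) d (Y : porderType d) (H : set V) (J : V -> Y) :
    set V :=
  [set f | H f /\ forall g, H g -> (J f <= J g)%O].

Definition input (a b : R) (d D : nat) (u : (d + D).-tuple R) : d.-tuple R :=
  [tuple a + (b - a) * tnth u (lshift D j) | j < d].

Definition risk disp (T : measurableType disp) (P : probability T R)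
    (a b : R) (d D : nat) (F : (d + D).-tuple R -> R)
    (U : T -> (d + D).-tuple R) (f : d.-tuple R -> R) : \bar R :=
  ('E_P[fun w => ((f (input a b (U w)) - F (U w)) ^+ 2)%R])%E.

Definition empirical_risk (a b : R) (d D : nat) (F : (d + D).-tuple R -> R)
    (u : nat -> (d + D).-tuple R) (n : nat) (f : d.-tuple R -> R) : R :=
  n%:R^-1 * \sum_(i < n) (f (input a b (u i)) - F (u i)) ^+ 2.

End Learning.

(* Main.v *)
Require Import Defs.
From HB Require Import structures.
From mathcomp Require Import all_boot all_order all_algebra all_fingroup.
From mathcomp Require Import all_classical all_reals all_analysis.
From mathcomp Require Import measurable_realfun.
From mathcomp Require Import ring lra.
Import Order.TTheory GRing.Theory Num.Theory.
Import numFieldNormedType.Exports.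
Local Open Scope classical_set_scope.
Local Open Scope ring_scope.

Set Implicit Arguments.
Unset Strict Implicit.
Unset Printing Implicit Defensive.

(** The excess risk of an empirical minimizer is at most the sum of two
    deviations between empirical risk and risk, those of the minimizer and of
    [fH]. So it is enough to bound, uniformly over the networks of the class, the
    error made when the loss [g = (f - F) ^ 2] is integrated with the points
    [u 0], .., [u (n - 1)], where [n = b ^ m].

    In one coordinate, let the sample at level [k] of a function be its value at
    the midpoint of the interval of length [b ^- k] that contains the point.
    Telescoping over [k], in each coordinate, writes [g] as a sum over
    multi-levels [k] of mixed increments ([sum_mixed_increment]). An increment
    whose total level is at most [m - t] is constant on elementary intervals that
    contain equal proportions of a net, so its average over the net is its
    integral ([net_exact], [mixed_increment_cell]). For any other increment, the
    mean value theorem applied in one coordinate after another turns the growth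
    condition, with exponent [eta], into the bound
      b ^ (- |k| (1 - 2 eta)) * prod_j (edge distance of x_j) ^ (- (1 - eta))
    ([node_increment], [mixed_increment_le]). The product is integrable, and
    since each point is uniform the mean of its average over the points is its
    integral. At most [(m + 2) ^ s] increments are concerned, [s] being the
    dimension, and [|k| >= m - t] for each, which gives
    [n ^ (- 1 + 2 eta)] up to a power of [log n]
    ([net_approximation], [sampling_error]).

    The bound depends on [g] only through the constants of its growth. They are
    common to all networks with parameters bounded by [r], because the
    derivatives of swish networks are bounded layer by layer ([growth_loss]).

    Finally, the scrambled points form a net almost surely: a uniform point
    almost surely has no coordinate on the grid of step [b ^- m], and off this
    grid the scrambling acts on each coordinate by a permutation of the intervals
    of each level up to [m] ([truncn_scramble], [net_counts_scrambling]). *)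

(** * Sampling one coordinate at the midpoints of its cells *)

Section EdgeDistance.
Context {R : realType}.
Implicit Types (x y p q eta : R).

Definition edge x : R := Num.min x (1 - x).

Lemma edge_gt0 x : 0 < x < 1 -> 0 < edge x.
Proof. by case/andP=> x0 x1; rewrite lt_min x0 subr_gt0 x1. Qed.

Lemma edge_le1 x : edge x <= 1.
Proof. by rewrite ge_min; case: (leP x 1) => //= x1; lra. Qed.

Lemma edge_lip x y : edge x <= edge y + `|y - x|.
Proof.
have := ler_norm (y - x); have := ler_norm (x - y); rewrite (distrC x y) => ? ?.
by rewrite /edge; case: (leP y (1 - y)) => _; rewrite ge_min; apply/orP; [left|right]; lra.
Qed.

Lemma le_edge (c x : R) : c <= x <= 1 - c -> c <= edge x.
Proof. by case/andP=> cx xc; rewrite le_min cx; lra. Qed.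

Lemma powR_antitone p x y : 0 <= p -> 0 < x -> x <= y -> y `^ (- p) <= x `^ (- p).
Proof.
move=> p0 x0 xy; have y0 : 0 < y by exact: lt_le_trans xy.
rewrite !powRN lef_pV2 ?posrE ?powR_gt0//.
by rewrite ge0_ler_powR ?nnegrE // ltW.
Qed.

(** What one level of refinement gains when the boundary growth has exponent
    [eta]: almost a factor [b]. *)
Definition decay (b : nat) eta : R := b%:R `^ (- (1 - 2 * eta)).

Lemma decayX (b : nat) eta k : decay b eta ^+ k = (b%:R ^+ k) `^ (- (1 - 2 * eta)).
Proof.
rewrite -[LHS]powR_mulrn ?powR_ge0// /decay -powRrM mulrC powRrM.
by rewrite powR_mulrn ?ler0n.
Qed.

Lemma decay_gt0 (b : nat) eta : (0 < b)%N -> 0 < decay b eta.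
Proof. by move=> b0; rewrite powR_gt0// ltr0n. Qed.

Definition node_const (b : nat) : R := 2 * b%:R * (1 + b%:R).

(** Away from the edges the mean value theorem applies with the bound on the
    derivative; the factor [edge ^ (- 2 eta)] of that bound is paid at scale
    [b ^- k], which leaves the integrable power [edge ^ (- (1 - eta))]. *)
Lemma interior_increment (b k : nat) (A eta : R) (h h' : R -> R) (x p q : R) :
    (2 <= b)%N -> 0 < eta -> 2 * eta <= 1 -> 0 <= A -> 0 < x < 1 ->
    (forall y, 0 < y < 1 -> is_derive y 1 h (h' y)) ->
    (forall y, 0 < y < 1 -> `|h' y| <= A * edge y `^ (- (eta + 1))) ->
    b%:R ^- k / 2 <= p <= 1 - b%:R ^- k / 2 ->
    b%:R ^- k / 2 <= q <= 1 - b%:R ^- k / 2 ->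
    `|p - x| <= b%:R * (b%:R ^- k / 2) -> `|q - x| <= b%:R * (b%:R ^- k / 2) ->
  `|h p - h q|
    <= A * (node_const b * decay b eta ^+ k * edge x `^ (- (1 - eta))).
Proof.
move=> b2 eta0 eta1 A0 x01 dh bh' + + + +.
have b0 : 0 < b%:R :> R by rewrite ltr0n (leq_trans _ b2).
have bk0 : 0 < b%:R ^+ k :> R by rewrite exprn_gt0.
have ex0 := edge_gt0 x01.
set c := b%:R ^- k / 2; have c0 : 0 < c by rewrite divr_gt0 // invr_gt0.
have rhs0 : 0 <= A * (node_const b * decay b eta ^+ k * edge x `^ (- (1 - eta))).
  by rewrite !mulr_ge0 ?powR_ge0 ?exprn_ge0 ?powR_ge0 // ?addr_ge0 // ltW.
wlog pq : p q / p < q => [hw|] hp hq px qx.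
  have [pq|qp|->] := ltgtP p q; first exact: hw.
    by rewrite distrC; apply: hw.
  by rewrite subrr normr0.
have in01 y : c <= y <= 1 - c -> 0 < y < 1 by case/andP=> ? ?; apply/andP; split; lra.
have [||xi] := @MVT R h h' p q pq.
- move=> y; rewrite in_itv/= => /andP[py yq]; apply: dh; apply: in01.
  by apply/andP; split; lra.
- apply: derivable_within_continuous => y; rewrite in_itv/= => /andP[py yq].
  have /dh dy : 0 < y < 1 by apply: in01; apply/andP; split; lra.
  by case: dy.
rewrite in_itv/= => /andP[pxi xiq] hpq.
have cxi : c <= xi <= 1 - c by apply/andP; split; lra.
have exi := le_edge cxi.
have exi0 : 0 < edge xi by lra.
have xi_x : `|xi - x| <= b%:R * c.
  by move: px qx; rewrite !ler_norml => /andP[? ?] /andP[? ?]; apply/andP; split; lra.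
have exx : edge x / (1 + b%:R) <= edge xi.
  rewrite ler_pdivrMr; last lra.
  have := edge_lip x xi; have := ler_wpM2l (ltW b0) exi; lra.
have qp : `|q - p| <= b%:R * b%:R ^- k.
  have -> : b%:R * b%:R ^- k = 2 * (b%:R * c) by rewrite /c; lra.
  by move: px qx; rewrite !ler_norml => /andP[? ?] /andP[? ?]; apply/andP; split; lra.
rewrite distrC hpq normrM.
apply: (@le_trans _ _ ((A * edge xi `^ (- (eta + 1))) * (b%:R * b%:R ^- k))).
  by apply: ler_pM => //; apply: bh'; apply: in01.
have -> : edge xi `^ (- (eta + 1)) = edge xi `^ (- (2 * eta)) * edge xi `^ (- (1 - eta)).
  rewrite -powRD; first by congr (_ `^ _); lra.
  by apply/implyP => _; rewrite gt_eqF.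
have e1 : edge xi `^ (- (2 * eta)) <= 2 * (b%:R ^+ k) `^ (2 * eta).
  apply: (@le_trans _ _ (c `^ (- (2 * eta)))); first by apply: powR_antitone => //; lra.
  have -> : (b%:R ^- k / 2) `^ (- (2 * eta)) = (2 * b%:R ^+ k : R) `^ (2 * eta).
    rewrite powRN -powR_inv1 ?powR_ge0// powRAC powR_inv1 ?divr_ge0 ?invr_ge0 ?ltW//.
    by rewrite invf_div invrK.
  rewrite powRM ?(ltW bk0)// ler_wpM2r ?powR_ge0//.
  by rewrite ler1_powR // ler1n.
have e2 : edge xi `^ (- (1 - eta)) <= (1 + b%:R) * edge x `^ (- (1 - eta)).
  apply: (@le_trans _ _ ((edge x / (1 + b%:R)) `^ (- (1 - eta)))).
    by apply: powR_antitone => //; [lra | rewrite divr_gt0//; lra].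
  have b1 : 0 < 1 + b%:R :> R by lra.
  rewrite powRM ?(ltW ex0) ?invr_ge0 ?(ltW b1)//.
  rewrite mulrC ler_wpM2r ?powR_ge0//.
  rewrite -powR_inv1 ?(ltW b1)//.
  rewrite -powRrM mulN1r opprK.
  by apply: ler1_powR; lra.
have e3 : (b%:R ^+ k) `^ (2 * eta) * b%:R ^- k = decay b eta ^+ k.
  rewrite decayX -[X in _ * X]powR_inv1 ?(ltW bk0)// -powRD; last by rewrite (gt_eqF bk0) implybT.
  by congr (_ `^ _); lra.
apply: (@le_trans _ _ (A * (2 * (b%:R ^+ k) `^ (2 * eta) * ((1 + b%:R) * edge x `^ (- (1 - eta)))) * (b%:R * b%:R ^- k))).
  rewrite ler_wpM2r ?mulr_ge0 ?invr_ge0 ?(ltW b0) ?(ltW bk0)// ler_wpM2l//.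
  by apply: ler_pM; rewrite ?powR_ge0.
by rewrite -e3 /node_const le_eqVlt; apply/orP; left; apply/eqP; ring.
Qed.

Definition midpoint (b k : nat) x : R :=
  ((Num.truncn (x * b%:R ^+ k))%:R + 2^-1) / b%:R ^+ k.

(** Above level [m] the point itself is used, so that a sum of increments over
    the levels up to [m.+1] telescopes to the function. *)
Definition node (b m k : nat) x : R := if (k <= m)%N then midpoint b k x else x.

Lemma truncn_cell (b k : nat) x : (0 < b)%N -> 0 <= x < 1 ->
  (Num.truncn (x * b%:R ^+ k) < b ^ k)%N.
Proof.
move=> b0 /andP[x0 x1]; rewrite truncn_lt_nat ?mulr_ge0// natrX.
by rewrite gtr_pMl // exprn_gt0 // ltr0n.
Qed.

Lemma midpoint_itv (b k : nat) x : (0 < b)%N -> 0 <= x < 1 ->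
  b%:R ^- k / 2 <= midpoint b k x <= 1 - b%:R ^- k / 2.
Proof.
move=> b0 x01; have bk0 : 0 < b%:R ^+ k :> R by rewrite exprn_gt0 // ltr0n.
have := truncn_cell k b0 x01; rewrite /midpoint; set N := Num.truncn _ => Nb.
have NR : N%:R + 1 <= b%:R ^+ k :> R by rewrite -natrX natr1 ler_nat.
set c := b%:R ^- k; have c0 : 0 < c by rewrite invr_gt0.
have Nc0 : 0 <= N%:R * c by rewrite mulr_ge0 ?ler0n ?ltW.
have Nc1 : (N%:R + 1) * c <= 1 by rewrite ler_pdivrMr// mul1r.
by apply/andP; split; lra.
Qed.

Lemma midpoint_dist (b k : nat) x : (0 < b)%N -> 0 <= x ->
  `|midpoint b k x - x| <= b%:R ^- k / 2.
Proof.
move=> b0 x0; have bk0 : 0 < b%:R ^+ k :> R by rewrite exprn_gt0 // ltr0n.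
have /truncn_itv /andP[h1 h2] : 0 <= x * b%:R ^+ k by rewrite mulr_ge0 // ltW.
rewrite /midpoint; set N := Num.truncn _ in h1 h2 *.
set c := b%:R ^- k; have c0 : 0 < c by rewrite invr_gt0.
have xc1 : N%:R * c <= x by rewrite ler_pdivrMr.
have xc2 : x < (N%:R + 1) * c by rewrite natr1 ltr_pdivlMr.
by rewrite ler_norml; apply/andP; split; lra.
Qed.

Lemma node_in01 (b m k : nat) x : (0 < b)%N -> 0 < x < 1 -> 0 < node b m k x < 1.
Proof.
move=> b0 x01; rewrite /node; case: ifP => // _.
have /(midpoint_itv k b0) : 0 <= x < 1 by case/andP: x01 => /ltW-> ->.
have : 0 < b%:R ^- k :> R by rewrite invr_gt0 exprn_gt0 // ltr0n.
by move=> h /andP[h1 h2]; apply/andP; split; lra.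
Qed.

Lemma edge_powRN_ge1 x p : 0 <= p -> 0 < x < 1 -> 1 <= edge x `^ (- p).
Proof.
move=> p0 x01; have <- : 1 `^ (- p) = 1 :> R by rewrite powR1.
by apply: powR_antitone => //; [exact: edge_gt0 | exact: edge_le1].
Qed.

Lemma node_const_ge2 b : (2 <= b)%N -> 2 <= node_const b.
Proof.
move=> b2; have h : 2 <= b%:R :> R by rewrite ler_nat.
by rewrite /node_const; nra.
Qed.

Lemma half_powRN eta : 0 < eta -> 2 * eta <= 1 -> (1 / 2) `^ (- eta) <= 2 :> R.
Proof.
move=> eta0 eta1; rewrite mul1r -powR_inv1// -powRrM mulN1r opprK.
by apply: ler1_powR; lra.
Qed.

(** The cost of refining one coordinate from level [k.-1] to level [k]. The
    bound has the integrable shape [edge x ^ (- (1 - eta))] at every level; at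
    the last one, where the sampling point jumps from a midpoint to [x] itself
    and may come arbitrarily near the edge, the increment is bounded by the two
    values of [h] instead of by the derivative. *)
Lemma node_increment (b m k : nat) (A eta : R) (h h' : R -> R) (x : R) :
    (2 <= b)%N -> 0 < eta -> 2 * eta <= 1 -> 0 <= A -> 0 < x < 1 ->
    (forall y, 0 < y < 1 -> is_derive y 1 h (h' y)) ->
    (forall y, 0 < y < 1 -> `|h y| <= A * edge y `^ (- eta)) ->
    (forall y, 0 < y < 1 -> `|h' y| <= A * edge y `^ (- (eta + 1))) ->
  `|h (node b m k x) - (0 < k)%N%:R * h (node b m k.-1 x)|
    <= A * (node_const b * decay b eta ^+ k * edge x `^ (- (1 - eta))).
Proof.
move=> b2 eta0 eta1 A0 x01 dh bh bh'.
have bN0 : (0 < b)%N by exact: leq_trans b2.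
have b0 : 0 < b%:R :> R by rewrite ltr0n.
have bge2 : 2 <= b%:R :> R by rewrite ler_nat.
have c2 := node_const_ge2 b2.
have x0 : 0 <= x by case/andP: x01 => /ltW.
have x01' : 0 <= x < 1 by case/andP: x01 => _ ->; rewrite x0.
have ex1 : 1 <= edge x `^ (- (1 - eta)) by apply: edge_powRN_ge1 => //; lra.
have bj0 j : 0 < b%:R ^- j :> R by rewrite invr_gt0 exprn_gt0.
have bS j : b%:R * (b%:R ^- j.+1 / 2) = b%:R ^- j / 2 :> R.
  by rewrite exprS invfM !mulrA mulfV ?mul1r ?gt_eqF.
have bE j : b%:R ^- j.+1 <= b%:R ^- j :> R.
  have := bS j; have := bj0 j.+1; nra.
case: k => [|k].
  rewrite mul0r subr0 expr0 mulr1 /node leq0n.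
  have := midpoint_itv 0 bN0 x01'; set z := midpoint _ _ _ => z01.
  have z01' : 0 < z < 1.
    by move: z01; rewrite expr0 invr1 => /andP[? ?]; apply/andP; split; lra.
  apply: le_trans (bh _ z01') _; apply: ler_wpM2l => //.
  have -> : edge z `^ (- eta) = edge z `^ (- eta) * 1 by rewrite mulr1.
  apply: ler_pM; rewrite ?powR_ge0//.
  apply: le_trans c2; apply: le_trans (half_powRN eta0 eta1).
  apply: powR_antitone; [exact: ltW|lra|apply: le_edge].
  by move: z01; rewrite expr0 invr1.
rewrite mul1r /=.
have [km|mk] := leqP k.+1 m.
  have km' : (k <= m)%N by exact: ltnW.
  rewrite /node km km'.
  have := midpoint_itv k.+1 bN0 x01'; have := midpoint_itv k bN0 x01'.
  have := midpoint_dist k.+1 bN0 x0; have := midpoint_dist k bN0 x0.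
  move=> d1 d2 /andP[i1 i2] /andP[i3 i4]; have := bE k => bEk.
  apply: (interior_increment (h' := h')) => //; rewrite ?bS//.
  - by rewrite i3 i4.
  - by apply/andP; split; lra.
  - by apply: le_trans d2 _; lra.
rewrite ltnS in mk; rewrite /node (leqNgt k.+1 m) ltnS mk /=.
have [km|mk'] := leqP k m; last first.
  have nc0 : 0 <= node_const b :> R by lra.
  rewrite subrr normr0 mulr_ge0// mulr_ge0 ?powR_ge0// mulr_ge0//.
  by rewrite exprn_ge0 ?powR_ge0.
have i0 := midpoint_itv k bN0 x01'; have i0' := i0; move/andP: i0 => [i1 i2].
have d1 := midpoint_dist k bN0 x0; have bEk := bE k.
(* now [k = m]: the increment goes from the midpoint at level [m] to [x] *)
have [xedge|xedge] := leP (b%:R ^- k / 2) (edge x).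
  have /andP[xb1 xb2] : b%:R ^- k / 2 <= x <= 1 - b%:R ^- k / 2.
    by move: xedge; rewrite /edge le_min => /andP[-> ?]; lra.
  apply: (interior_increment (h' := h')) => //; rewrite ?bS//.
  - by apply/andP; split; lra.
  - by apply/andP; split; lra.
  - by rewrite subrr normr0; have := bj0 k; lra.
set z := midpoint b k x in i0' i1 i2 d1 *.
have z01 : 0 < z < 1 by have := bj0 k; move=> ?; apply/andP; split; lra.
have ez := le_edge i0'.
have ex0 := edge_gt0 x01.
apply: (@le_trans _ _ (A * (2 * edge x `^ (- eta)))).
  apply: le_trans (ler_normB _ _) _.
  apply: (@le_trans _ _ (A * edge x `^ (- eta) + A * edge z `^ (- eta))).
    by apply: lerD; [exact: bh | exact: bh].
  rewrite -mulrDr ler_wpM2l// mulr2n mulrDl mul1r lerD2l.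
  by apply: powR_antitone; lra.
apply: ler_wpM2l => //.
(* here [edge x < b ^- k / 2], so the first factor is at most [decay b eta ^+ k] *)
have -> : edge x `^ (- eta) = edge x `^ (1 - 2 * eta) * edge x `^ (- (1 - eta)).
  rewrite -powRD; first by congr (_ `^ _); lra.
  by apply/implyP => _; rewrite gt_eqF.
rewrite mulrA ler_wpM2r ?powR_ge0//.
have le1 : edge x `^ (1 - 2 * eta) <= (b%:R ^- k) `^ (1 - 2 * eta).
  by have bk := bj0 k; apply: ge0_ler_powR; rewrite ?nnegrE ?(ltW ex0) ?(ltW bk)//; lra.
have eqk : (b%:R ^- k) `^ (1 - 2 * eta) = decay b eta ^+ k.
  rewrite decayX -[in LHS]powR_inv1 ?exprn_ge0 ?ler0n//.
  by rewrite -powRrM mulN1r.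
have db : 1 <= b%:R * decay b eta.
  apply: (@le_trans _ _ (b%:R * b%:R `^ (- 1))).
    by rewrite powR_inv1 ?ler0n// mulfV// gt_eqF.
  by rewrite ler_wpM2l ?ler0n// /decay; apply: ler_powR; lra.
rewrite eqk in le1; apply: (@le_trans _ _ (2 * decay b eta ^+ k)).
  by rewrite ler_wpM2l.
have d0 : 0 <= decay b eta ^+ k by rewrite exprn_ge0 ?powR_ge0.
rewrite exprS mulrA ler_wpM2r// /node_const; nra.
Qed.

End EdgeDistance.

(** * Functions with controlled mixed derivatives *)

Section GrowthClass.
Context {R : realType} {s : nat}.
Implicit Types (e : 'I_s -> R) (G : s.-tuple R -> R) (u : s.-tuple R)
  (l : seq 'I_s) (j : 'I_s) (A : R).

Lemma tnth_coord_line u j x i :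
  tnth (coord_line u j x) i = if i == j then x else tnth u i.
Proof. by rewrite tnth_mktuple. Qed.

Lemma coord_line_id u j : coord_line u j (tnth u j) = u.
Proof. by apply: eq_from_tnth => i; rewrite tnth_coord_line; case: eqP => [->|]. Qed.

Lemma coord_line_line u j x y : coord_line (coord_line u j x) j y = coord_line u j y.
Proof. by apply: eq_from_tnth => i; rewrite !tnth_coord_line; case: eqP. Qed.

Lemma coord_lineC u i j x y : i != j ->
  coord_line (coord_line u i x) j y = coord_line (coord_line u j y) i x.
Proof.
move=> ij; apply: eq_from_tnth => k; rewrite !tnth_coord_line.
by case: (eqVneq k j) => [->|]//; rewrite eq_sym (negbTE ij).
Qed.

Lemma open_cube_line u j x : open_cube u -> 0 < x < 1 -> open_cube (coord_line u j x).
Proof. by move=> cu x01 i; rewrite tnth_coord_line; case: eqP. Qed.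

Definition edge_weight e u : R := \prod_i edge (tnth u i) `^ (- e i).

Lemma edge_weight_gt0 e u : open_cube u -> 0 < edge_weight e u.
Proof. by move=> cu; apply: prodr_gt0 => i _; rewrite powR_gt0// edge_gt0. Qed.

Lemma le_edge_weight e e' u : open_cube u -> (forall i, e i <= e' i) ->
  edge_weight e u <= edge_weight e' u.
Proof.
move=> cu ee'; apply: ler_prod => i _; rewrite powR_ge0 /=.
by apply: ger_powR; rewrite ?edge_gt0 ?edge_le1// lerN2.
Qed.

Lemma edge_weightD e e' u : open_cube u ->
  edge_weight (e \+ e') u = edge_weight e u * edge_weight e' u.
Proof.
move=> cu; rewrite -big_split; apply: eq_bigr => i _ /=; rewrite opprD powRD//.
by apply/implyP => _; rewrite gt_eqF// edge_gt0.
Qed.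

Lemma edge_weight_ge1 e u : open_cube u -> (forall i, 0 <= e i) -> 1 <= edge_weight e u.
Proof.
move=> cu e0; rewrite -[leLHS](_ : edge_weight (fun=> 0) u = 1).
  exact: le_edge_weight.
by rewrite /edge_weight big1// => i _; rewrite oppr0 powRr0.
Qed.

Definition incr e j : 'I_s -> R := fun i => e i + (i == j)%:R.

(** Differentiability is asked once for each index of [l], in the order of
    [l] and with the freedom to skip indices; this is what a function gives
    whose mixed partials [mixed_partial v], [v] a set, exist and grow at the
    prescribed rate. The derivatives are existentially quantified, so that the
    class is visibly closed under sums, products and compositions. *)
Fixpoint growth l e A G : Prop :=
  if l is j :: l' then
    growth l' e A G /\
    exists2 G', (forall u, open_cube u ->
                   is_derive (tnth u j) 1 (fun x => G (coord_line u j x)) (G' u)) &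
      growth l' (incr e j) A G'
  else forall u, open_cube u -> `|G u| <= A * edge_weight e u.

Lemma growth_le l e e' A A' G : (forall i, e i <= e' i) -> 0 <= A <= A' ->
  growth l e A G -> growth l e' A' G.
Proof.
move=> + /andP[A0 AA']; elim: l G e e' => [|j l IH] G e e' ee' /=.
  move=> h u cu; apply: le_trans (h u cu) _; apply: ler_pM => //.
    exact/ltW/edge_weight_gt0.
  exact: le_edge_weight.
move=> [h [G' dG hG']]; split; first exact: IH ee' h.
by exists G' => //; apply: (IH _ _ _ _ hG') => i; rewrite lerD2r.
Qed.

Lemma growthD l e A B G H : growth l e A G -> growth l e B H ->
  growth l e (A + B) (fun u => G u + H u).
Proof.
elim: l G H e => [|j l IH] G H e /=.
  move=> hG hH u cu; apply: le_trans (ler_normD _ _) _.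
  by rewrite mulrDl lerD ?hG ?hH.
move=> [hG [G' dG hG']] [hH [H' dH hH']]; split; first exact: IH.
exists (fun u => G' u + H' u); last exact: IH.
by move=> u cu; have := dG u cu; have := dH u cu => ? ?; exact: is_deriveD.
Qed.

Lemma growth_const l e c : (forall i, 0 <= e i) -> growth l e `|c| (fun=> c).
Proof.
elim: l c e => [|j l IH] c e e0 /=.
  move=> u cu; rewrite -[leLHS]mulr1 ler_wpM2l//; exact: edge_weight_ge1.
split; first exact: IH.
exists (fun=> 0) => [u cu|]; first exact: is_derive_cst.
have e0' i : 0 <= incr e j i by rewrite addr_ge0 ?ler0n.
by have := IH 0 _ e0'; apply: growth_le; rewrite // normr0 lexx /=.
Qed.

(** Leibniz rule: each differentiation doubles the number of terms. *)
Lemma growthM l e e' A B G H : 0 <= A -> 0 <= B ->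
  growth l e A G -> growth l e' B H ->
  growth l (e \+ e') (2 ^+ size l * (A * B)) (fun u => G u * H u).
Proof.
move=> A0 B0; have AB0 : 0 <= A * B by rewrite mulr_ge0.
elim: l G H e e' => [|j l IH] G H e e' /=.
  move=> hG hH u cu; rewrite mul1r normrM edge_weightD// mulrACA.
  by apply: ler_pM => //; [exact: hG | exact: hH].
move=> [hG [G' dG hG']] [hH [H' dH hH']]; split.
  have := IH _ _ _ _ hG hH; apply: growth_le => //.
  by rewrite mulr_ge0 ?exprn_ge0//= ler_wpM2r// exprS ler_peMl ?exprn_ge0// ler1n.
exists (fun u => G' u * H u + G u * H' u).
  move=> u cu; have dGu := dG u cu; have dHu := dH u cu.
  apply: is_derive_eq (is_deriveM dGu dHu) _.
  by rewrite !coord_line_id /= addrC; congr (_ + _); rewrite mulrC.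
have -> : 2 ^+ (size l).+1 * (A * B) =
    2 ^+ size l * (A * B) + 2 ^+ size l * (A * B) by rewrite exprS; ring.
apply: growthD.
  have := IH _ _ _ _ hG' hH; apply: growth_le; last by rewrite lexx mulr_ge0 ?exprn_ge0.
  by move=> i; rewrite /incr /= addrAC.
have := IH _ _ _ _ hG hH'; apply: growth_le; last by rewrite lexx mulr_ge0 ?exprn_ge0.
by move=> i; rewrite /incr /= addrA.
Qed.

Lemma growth_affine_coord l e (a c : R) j : (forall i, 0 <= e i) ->
  growth l e (`|a| + `|c|) (fun u => a + c * tnth u j).
Proof.
elim: l e => [|i l IH] e e0 /=.
  move=> u cu; apply: (@le_trans _ _ ((`|a| + `|c|) * 1)).
    rewrite mulr1; apply: le_trans (ler_normD _ _) _; rewrite lerD2l normrM.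
    rewrite ler_piMr//; have /andP[u0 u1] := cu j.
    by rewrite gtr0_norm// ltW.
  by rewrite ler_wpM2l ?addr_ge0//; exact: edge_weight_ge1.
split; first exact: IH.
have e0' k : 0 <= incr e i k by rewrite addr_ge0 ?ler0n.
exists (fun=> c * (j == i)%:R).
  move=> u cu.
  case: (eqVneq j i) => [->|ji].
    have -> : (fun x => a + c * tnth (coord_line u i x) i) = (fun x => a + c * x).
      by apply/funext => x; rewrite tnth_coord_line eqxx.
    by apply: is_derive_eq; rewrite add0r mul1r /=; exact: erefl.
  have -> : (fun x => a + c * tnth (coord_line u i x) j) = (fun=> a + c * tnth u j).
    by apply/funext => x; rewrite tnth_coord_line (negbTE ji).
  by rewrite mulr0; exact: is_derive_cst.
have := growth_const l (c * (j == i)%:R) e0'; apply: growth_le => //.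
rewrite normr_ge0 normrM /=; case: eqP => _; rewrite ?normr1 ?normr0 ?mulr1 ?mulr0.
  by rewrite lerDr.
by rewrite addr_ge0.
Qed.

Lemma growth_sum l e A n (G : 'I_n -> s.-tuple R -> R) : (forall i, 0 <= e i) ->
  (forall i, growth l e A (G i)) -> growth l e (n%:R * A) (fun u => \sum_i G i u).
Proof.
move=> e0; elim: n G => [|n IH] G hG.
  have -> : (fun u => \sum_i G i u) = (fun=> 0) by apply/funext => u; rewrite big_ord0.
  by have := growth_const l 0 e0; rewrite normr0 mul0r.
have -> : (fun u => \sum_i G i u) =
    (fun u => \sum_(i < n) G (widen_ord (leqnSn n) i) u + G ord_max u).
  by apply/funext => u; rewrite big_ord_recr.
by rewrite -natr1 mulrDl mul1r; apply: growthD => //; exact: IH.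
Qed.

Lemma growth_scale l e A c G : 0 <= A -> (forall i, 0 <= e i) -> growth l e A G ->
  growth l e (2 ^+ size l * (`|c| * A)) (fun u => c * G u).
Proof.
move=> A0 e0 hG.
have := growthM (normr_ge0 c) A0 (@growth_const l (fun=> 0) c (fun=> lexx 0)) hG.
apply: growth_le => [i|]; first by rewrite /= add0r.
by rewrite lexx !mulr_ge0 ?exprn_ge0.
Qed.
End GrowthClass.

(** * Growth of networks and of the target function *)

Section NetworkGrowth.
Context {R : realType} {s : nat}.
Implicit Types (e : 'I_s -> R) (G : s.-tuple R -> R) (u : s.-tuple R)
  (l : seq 'I_s) (j : 'I_s) (A : R).

Definition sigmoid (y : R) : R := (1 + expR (- y))^-1.

Lemma sigmoid_itv y : 0 < sigmoid y <= 1.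
Proof.
have e0 := expR_gt0 (- y).
by rewrite invr_gt0 invf_le1; [apply/andP; split; lra | lra].
Qed.

Lemma is_derive_sigmoid (f : R -> R) (x df : R) : is_derive x 1 f df ->
  is_derive x 1 (fun x => sigmoid (f x)) (sigmoid (f x) * (1 - sigmoid (f x)) * df).
Proof.
move=> dfx; have e0 := expR_gt0 (- f x).
have n0 : 1 + expR (- f x) != 0 by rewrite gt_eqF// addr_gt0.
have dg : is_derive x 1 (fun x => 1 + expR (- f x)) (- expR (- f x) * df).
  have dN := is_deriveN dfx.
  have dE := @is_derive1_comp _ expR (- f) x _ _ (is_derive_expR ((- f) x)) dN.
  apply: is_derive_eq (is_deriveD (is_derive_cst (1 : R) x (1 : R)) dE) _.
  by rewrite add0r mulrN mulNr.
have [dg1 dg2] := dg.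
apply: DeriveDef; first exact: derivableV.
rewrite deriveV// dg2.
rewrite /sigmoid /GRing.scale /=; field.
by rewrite n0.
Qed.

(** The derivative of the sigmoid is a polynomial in the sigmoid, so the bounds
    for fewer derivatives give those for one more. *)
Lemma growth_sigmoid l A : 0 <= A -> exists2 A', 0 <= A' &
  forall G, growth l (fun=> 0) A G -> growth l (fun=> 0) A' (fun u => sigmoid (G u)).
Proof.
move=> A0; elim: l => [|j l [B B0 IH]] /=.
  exists 1 => // G hG u cu; have /andP[h0 h1] := sigmoid_itv (G u).
  rewrite gtr0_norm// mul1r; apply: le_trans h1 _; exact: edge_weight_ge1.
pose C := 2 ^+ size l * (B * (1 + 2 ^+ size l * (`|-1| * B))).
have p0 : 0 <= 2 ^+ size l :> R by rewrite exprn_ge0.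
have E0 : 0 <= 1 + 2 ^+ size l * (`|-1| * B) by rewrite addr_ge0 ?mulr_ge0.
have C0 : 0 <= C by rewrite !mulr_ge0.
have D0 : 0 <= 2 ^+ size l * (C * A) by rewrite !mulr_ge0.
exists (B + 2 ^+ size l * (C * A)); first by rewrite addr_ge0.
move=> G [hG [G' dG hG']]; have sG := IH G hG; split.
  by apply: growth_le sG => //; rewrite B0 lerDl.
exists (fun u => sigmoid (G u) * (1 - sigmoid (G u)) * G' u).
  move=> u cu; have := is_derive_sigmoid (dG u cu).
  by rewrite coord_line_id.
have sc : growth l (fun=> 0) C (fun u => sigmoid (G u) * (1 - sigmoid (G u))).
  have h1 : growth l (fun=> 0) (1 + 2 ^+ size l * (`|-1| * B))
      (fun u => 1 - sigmoid (G u)).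
    have -> : (fun u => 1 - sigmoid (G u)) = (fun u => 1 + (-1) * sigmoid (G u)).
      by apply/funext => u; rewrite mulN1r.
    apply: growthD; last exact: growth_scale.
    by have := @growth_const R s l (fun=> 0) 1 (fun=> lexx _); rewrite normr1.
  have := growthM B0 E0 sG h1; apply: growth_le; last by rewrite lexx C0.
  by move=> i /=; rewrite addr0.
have := growthM C0 A0 sc hG'; apply: growth_le; last by rewrite D0 lerDr.
by move=> i /=; rewrite /incr !add0r.
Qed.

Lemma growth_swish l A : 0 <= A -> exists2 A', 0 <= A' &
  forall G, growth l (fun=> 0) A G -> growth l (fun=> 0) A' (fun u => swish (G u)).
Proof.
move=> A0; have [B B0 hB] := growth_sigmoid l A0.
exists (2 ^+ size l * (A * B)); first by rewrite !mulr_ge0 ?exprn_ge0.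
move=> G hG; have := growthM A0 B0 hG (hB G hG); apply: growth_le => [i|].
  by rewrite /= addr0.
by rewrite lexx !mulr_ge0 ?exprn_ge0.
Qed.

Lemma mx_entry_norm m n (M : 'M[R]_(m, n)) (r : R) i (j : 'I_n) : mx_norm M <= r -> `|M i j| <= r.
Proof.
rewrite mx_normrE; apply: le_trans.
by apply: (le_bigmax _ (fun ij => `|M ij.1 ij.2|) (i, j)).
Qed.

Lemma growth_layer l A (r : R) m n (AB : 'M[R]_(m, n) * 'cV[R]_m)
    (x : s.-tuple R -> 'cV[R]_n) : 0 <= A -> layer_norm AB <= r ->
    (forall i, growth l (fun=> 0) A (fun u => x u i 0)) ->
  forall i, growth l (fun=> 0) (n%:R * (2 ^+ size l * (r * A)) + r)
                             (fun u => affine AB (x u) i 0).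
Proof.
move=> A0; rewrite /layer_norm ge_max => /andP[nA nB] hx i.
have r0 : 0 <= r by exact: le_trans (mx_entry_norm i 0 nB).
have -> : (fun u => affine AB (x u) i 0) =
    (fun u => \sum_j AB.1 i j * x u j 0 + AB.2 i 0).
  by apply/funext => u; rewrite !mxE.
apply: growthD; last first.
  have := @growth_const R s l (fun=> 0) (AB.2 i 0) (fun=> lexx _).
  by apply: growth_le => //; rewrite normr_ge0 mx_entry_norm.
apply: growth_sum => // j; have := growth_scale (AB.1 i j) A0 (fun=> lexx 0) (hx j).
apply: growth_le => //; rewrite !mulr_ge0 ?exprn_ge0//=.
by rewrite ler_wpM2l ?exprn_ge0// ler_wpM2r// mx_entry_norm.
Qed.

(** The derivatives of a network are bounded uniformly over the parameters: the
    bound is built layer by layer from [r] and the widths alone. *)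
Lemma growth_realization l (r : R) : 0 <= r ->
  forall (h : seq nat) din A, 0 <= A -> exists2 A', 0 <= A' &
  forall (th : nn_params din h) (x : s.-tuple R -> 'cV[R]_din), nn_norm th <= r ->
    (forall i, growth l (fun=> 0) A (fun u => x u i 0)) ->
    growth l (fun=> 0) A' (fun u => realization th (x u)).
Proof.
move=> r0; have p0 : 0 <= 2 ^+ size l :> R by rewrite exprn_ge0.
elim=> [|n h IH] din A A0.
  exists (din%:R * (2 ^+ size l * (r * A)) + r); first by rewrite addr_ge0 ?mulr_ge0.
  by move=> th x nth hx; exact: growth_layer.
have B0 : 0 <= din%:R * (2 ^+ size l * (r * A)) + r by rewrite addr_ge0 ?mulr_ge0.
have [C C0 hC] := growth_swish l B0.
have [D D0 hD] := IH n C C0.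
exists D => // -[AB th] x; rewrite /= ge_max => /andP[nAB nth] hx.
apply: (hD th (fun u => map_mx swish (affine AB (x u)))) => // i.
have -> : (fun u => map_mx swish (affine AB (x u)) i 0) =
    (fun u => swish (affine AB (x u) i 0)) by apply/funext => u; rewrite mxE.
by apply: hC; exact: growth_layer.
Qed.
End NetworkGrowth.

Section GrowthOfMixedPartials.
Context {R : realType} {s : nat}.
Implicit Types (v : {set 'I_s}) (l : seq 'I_s) (j : 'I_s).

Lemma enum_setU1_lt v j : (forall i, i \in v -> (j < i)%N) -> enum (j |: v) = j :: enum v.
Proof.
move=> jv; pose lto := fun i k : 'I_s => (i < k)%N.
have lto_tr : transitive lto by move=> a b c; exact: ltn_trans.
have lto_irr : irreflexive lto by move=> a; exact: ltnn.
have st (w : {set 'I_s}) : sorted lto (enum w).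
  rewrite /enum_mem; apply: sorted_filter => //.
  have := iota_ltn_sorted 0 s; rewrite -val_enum_ord sorted_map.
  by rewrite enumT.
apply: (irr_sorted_eq lto_tr lto_irr) => //=.
  rewrite (path_sortedE lto_tr) st andbT.
  by apply/allP => i; rewrite mem_enum => /jv.
by move=> i; rewrite inE !mem_enum !inE.
Qed.

(** A mixed partial takes the derivative of largest index first; a decreasing
    list of indices makes [growth] do the same. *)
Lemma growth_mixed_partial (F : s.-tuple R -> R) (Bs : 'I_s -> R) (delta : R) :
  (forall i, 0 < Bs i < delta) -> boundary_growth F Bs ->
  exists2 B, 0 <= B & forall l, sorted (fun i j : 'I_s => (j < i)%N) l ->
    growth l (fun=> delta) B F.
Proof.
move=> Bd [dF [B B0 hB]]; exists B; first exact: ltW.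
have gtr : transitive (fun i j : 'I_s => (j < i)%N).
  by move=> a b c ab ca; exact: ltn_trans ab.
suff H l v : sorted (fun i j : 'I_s => (j < i)%N) l ->
    (forall i j, i \in v -> j \in l -> (j < i)%N) ->
    growth l (fun i => delta + (i \in v)%:R) B (mixed_partial v F).
  move=> l sl; have := H l (@finset.set0 'I_s) sl.
  have -> : mixed_partial (@finset.set0 'I_s) F = F by rewrite /mixed_partial enum_set0.
  move=> {}H; apply: growth_le (H _) => [i||i j]; rewrite ?inE ?addr0//.
  by rewrite lexx ltW.
elim: l v => [|j l IH] v /= sl vl.
  move=> u cu; apply: le_trans (hB v u cu) _; rewrite ler_wpM2l ?(ltW B0)//.
  apply: ler_prod => i _; rewrite powR_ge0 /=.
  have h1 := edge_gt0 (cu i); have h2 := edge_le1 (tnth u i).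
  apply: ger_powR; first by rewrite h1.
  by rewrite opprD lerD2r lerN2 ltW//; case/andP: (Bd i).
have jv i : i \in v -> (j < i)%N by move=> iv; apply: vl => //; rewrite mem_head.
split.
  apply: IH; first exact: path_sorted sl.
  by move=> i k iv kl; apply: vl => //; rewrite inE kl orbT.
exists (mixed_partial (j |: v) F).
  move=> u cu; have := dF v j jv u cu => /derivableP dd.
  apply: is_derive_eq dd _.
  by rewrite /mixed_partial enum_setU1_lt//= /partial derive1E.
have := IH (j |: v) (path_sorted sl); move=> {}IH.
have {}IH : growth l (fun i => delta + (i \in j |: v)%:R) B (mixed_partial (j |: v) F).
  apply: IH => i k; rewrite !inE => /orP[/eqP->|iv] kl.
    by move: sl; rewrite (path_sortedE gtr) => /andP[/allP/(_ k kl)].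
  by apply: vl => //; rewrite inE kl orbT.
apply: growth_le IH; last by rewrite lexx ltW.
move=> i; rewrite /incr -addrA lerD2l in_setU1.
by case: (i == j); case: (i \in v) => /=; lra.
Qed.
End GrowthOfMixedPartials.

(** * Decomposition into mixed increments *)

Section MixedIncrement.
Context {R : realType} {s : nat} (b m : nat).
Implicit Types (e : 'I_s -> R) (G : s.-tuple R -> R) (x u : s.-tuple R)
  (l : seq 'I_s) (j : 'I_s) (A : R) (k : 'I_s -> nat).

(** The tensor product, over the coordinates in [l], of the differences between
    sampling at level [k j] and at the preceding level. *)
Fixpoint mixed_increment x k l G u : R :=
  if l is j :: l' then
    mixed_increment x k l' G (coord_line u j (node b m (k j) (tnth x j)))
    - (0 < k j)%N%:R *
      mixed_increment x k l' G (coord_line u j (node b m (k j).-1 (tnth x j)))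
  else G u.

Lemma is_derive_mixed_increment x k l j G G' : (0 < b)%N -> open_cube x ->
    (forall u, open_cube u ->
       is_derive (tnth u j) 1 (fun y => G (coord_line u j y)) (G' u)) ->
    j \notin l -> forall u, open_cube u ->
  is_derive (tnth u j) 1 (fun y => mixed_increment x k l G (coord_line u j y))
                         (mixed_increment x k l G' u).
Proof.
move=> b0 cx dG; elim: l => [|i l IH]; first by move=> _ u cu; exact: dG.
rewrite inE negb_or => /andP[ji jl] u cu /=.
have step p : 0 < p < 1 ->
    is_derive (tnth u j) 1
      (fun y => mixed_increment x k l G (coord_line (coord_line u j y) i p))
      (mixed_increment x k l G' (coord_line u i p)).
  move=> p01; have cu' := open_cube_line i cu p01.
  have := IH jl _ cu'; rewrite tnth_coord_line (negbTE ji).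
  have -> // : (fun y => mixed_increment x k l G (coord_line (coord_line u i p) j y)) =
      (fun y => mixed_increment x k l G (coord_line (coord_line u j y) i p)).
  by apply/funext => y; rewrite coord_lineC// eq_sym.
have d1 := step _ (node_in01 m (k i) b0 (cx i)).
have d2 := step _ (node_in01 m (k i).-1 b0 (cx i)).
by apply: is_derive_eq (is_deriveB d1 (is_deriveZ (0 < k i)%N%:R d2)) _.
Qed.

Definition increment_weight eta x k (i : 'I_s) : R :=
  node_const b * decay b eta ^+ k i * edge (tnth x i) `^ (- (1 - eta)).

(** Each coordinate of [l] is treated by [node_increment] applied to the
    increments in the coordinates that follow it in [l], whose derivative is
    the same increments of a derivative: this is why [growth] differentiates
    in the order of [l]. *)
Lemma mixed_increment_le x k l eta e A G : (2 <= b)%N -> 0 < eta -> 2 * eta <= 1 ->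
    0 <= A -> open_cube x -> uniq l -> (forall i, i \in l -> e i = eta) ->
    growth l e A G -> forall u, open_cube u ->
  `|mixed_increment x k l G u| <=
    A * \prod_i (if i \in l then increment_weight eta x k i
                 else edge (tnth u i) `^ (- e i)).
Proof.
move=> b2 eta0 eta1 A0 cx; have b0 : (0 < b)%N by exact: leq_trans b2.
elim: l e G => [|j l IH] e G /=; first by move=> _ _ h u cu; exact: h.
move=> /andP[jl ul] el [hG [G' dG hG']] u cu.
pose W i : R := if i \in l then increment_weight eta x k i
                else edge (tnth u i) `^ (- e i).
have ew0 i : 0 <= increment_weight eta x k i.
  by rewrite !mulr_ge0 ?powR_ge0 ?exprn_ge0 ?powR_ge0 ?addr_ge0.
have W0 i : 0 <= W i by rewrite /W; case: ifP => // _; rewrite powR_ge0.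
have ej : e j = eta by apply: el; rewrite mem_head.
have el' i : i \in l -> e i = eta by move=> il; apply: el; rewrite inE il orbT.
have line01 y : 0 < y < 1 -> open_cube (coord_line u j y).
  by move=> y01; exact: open_cube_line.
(* with [z = 0] for the function and [z = 1] for its derivative along [j] *)
have split_weight y (z : R) :
    \prod_i (if i \in l then increment_weight eta x k i
             else edge (tnth (coord_line u j y) i) `^ (- (e i + z * (i == j)%:R)))
    = (\prod_(i | i != j) W i) * edge y `^ (- (eta + z)).
  rewrite (bigD1 j)//= (negbTE jl) tnth_coord_line eqxx mulr1 ej mulrC.
  congr (_ * _); apply: eq_bigr => i ij.
  by rewrite tnth_coord_line (negbTE ij) mulr0 addr0.
set P := \prod_(i | i != j) W i in split_weight.
have P0 : 0 <= P by apply: prodr_ge0.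
have -> : \prod_i (if i \in j :: l then increment_weight eta x k i
             else edge (tnth u i) `^ (- e i)) = P * increment_weight eta x k j.
  rewrite (bigD1 j)//= mem_head mulrC; congr (_ * _).
  by apply: eq_bigr => i ij; rewrite inE (negbTE ij).
rewrite mulrA.
apply: (@node_increment R b m (k j) (A * P) eta
   (fun y => mixed_increment x k l G (coord_line u j y))
   (fun y => mixed_increment x k l G' (coord_line u j y)) (tnth x j)) => //.
- by rewrite mulr_ge0.
- move=> y y01.
  have := is_derive_mixed_increment k b0 cx dG jl (line01 _ y01).
  rewrite tnth_coord_line eqxx.
  have -> // : (fun y0 => mixed_increment x k l G (coord_line (coord_line u j y) j y0))
     = (fun y0 => mixed_increment x k l G (coord_line u j y0)).
  by apply/funext => y0; rewrite coord_line_line.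
- move=> y y01; have := IH e G ul el' hG _ (line01 _ y01).
  have := split_weight y 0; rewrite addr0 -mulrA => <-.
  move=> h; apply: le_trans h _; rewrite ler_wpM2l//.
  by rewrite le_eqVlt; apply/orP; left; apply/eqP; apply: eq_bigr => i _; rewrite mul0r addr0.
- move=> y y01.
  have el'' i : i \in l -> incr e j i = eta.
    move=> il; rewrite /incr el'//; case: eqP => [ij|]; last by rewrite addr0.
    by rewrite -ij il in jl.
  have := IH _ G' ul el'' hG' _ (line01 _ y01).
  have := split_weight y 1; rewrite -mulrA => <-.
  move=> h; apply: le_trans h _; rewrite ler_wpM2l//.
  by rewrite le_eqVlt; apply/orP; left; apply/eqP; apply: eq_bigr => i _; rewrite mul1r.
Qed.

Lemma eq_mixed_increment x k k' l G u : {in l, k =1 k'} ->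
  mixed_increment x k l G u = mixed_increment x k' l G u.
Proof.
elim: l u => //= j l IH u kk'; rewrite kk' ?mem_head//.
by rewrite !IH// => i il; apply: kk'; rewrite inE il orbT.
Qed.

Definition set_level k j (i : nat) : 'I_s -> nat := fun i' => if i' == j then i else k i'.

Fixpoint multi_levels l : seq ('I_s -> nat) :=
  if l is j :: l' then [seq set_level k j i | i <- iota 0 m.+2, k <- multi_levels l']
  else [:: fun=> 0%N].

Lemma size_multi_levels l : size (multi_levels l) = (m.+2 ^ size l)%N.
Proof.
elim: l => // j l IH.
rewrite (size_allpairs (fun i k => set_level k j i) (iota 0 m.+2) (multi_levels l)).
by rewrite size_iota IH expnS.
Qed.

Lemma telescope_increment (f : nat -> R) n :
  \sum_(i <- iota 0 n.+1) (f i - (0 < i)%N%:R * f i.-1) = f n.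
Proof.
elim: n => [|n IH]; first by rewrite /= big_seq1 mul0r subr0.
by rewrite -addn1 iotaD big_cat IH /= big_seq1 add0n mul1r addrC subrK.
Qed.

(** The sum over the levels telescopes in each coordinate, and its last term
    samples at the coordinate of [x] itself. *)
Lemma sum_mixed_increment x l G u : uniq l ->
  \sum_(k <- multi_levels l) mixed_increment x k l G u =
  G [tuple if i \in l then tnth x i else tnth u i | i < s].
Proof.
elim: l u => [|j l IH] u.
  move=> _; rewrite /= big_seq1; congr G; apply: eq_from_tnth => i.
  by rewrite tnth_mktuple.
rewrite cons_uniq => /andP[jl ul].
rewrite (big_allpairs_dep (h := fun i k => set_level k j i)) /=.
pose f i := \sum_(k <- multi_levels l)
  mixed_increment x k l G (coord_line u j (node b m i (tnth x j))).
transitivity (\sum_(i <- iota 0 m.+2) (f i - (0 < i)%N%:R * f i.-1)).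
  apply: eq_bigr => i _; rewrite /f mulr_sumr -sumrB; apply: eq_bigr => k _.
  have kl : {in l, set_level k j i =1 k}.
    by move=> i' il; rewrite /set_level; case: eqP => // ij; rewrite -ij il in jl.
  by rewrite !(eq_mixed_increment _ _ _ kl) /set_level eqxx.
rewrite telescope_increment /f IH//; congr G; apply: eq_from_tnth => i.
rewrite !tnth_mktuple inE /node ltnn.
by case: (eqVneq i j) => [->|]//; rewrite (negbTE jl).
Qed.
End MixedIncrement.

Section Cells.
Context {R : realType}.

Lemma truncn_div (y : R) (B : nat) : (0 < B)%N -> 0 <= y ->
  Num.truncn (y / B%:R) = (Num.truncn y %/ B)%N.
Proof.
move=> B0 y0; have /andP[h1 h2] := truncn_itv y0.
have B0' : 0 < B%:R :> R by rewrite ltr0n.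
apply: truncn_def; rewrite ler_pdivlMr// ltr_pdivrMr// -!natrM; apply/andP; split.
  by apply: le_trans h1; rewrite ler_nat leq_trunc_div.
by apply: lt_le_trans h2 _; rewrite ler_nat; exact: ltn_ceil.
Qed.

Lemma truncn_refine (b k k' : nat) (x : R) : (0 < b)%N -> 0 <= x -> (k <= k')%N ->
  Num.truncn (x * b%:R ^+ k) = (Num.truncn (x * b%:R ^+ k') %/ b ^ (k' - k))%N.
Proof.
move=> b0 x0 kk'; rewrite -truncn_div ?expn_gt0 ?b0//; last by rewrite mulr_ge0.
have bn0 : (b ^ (k' - k))%:R != 0 :> R by rewrite pnatr_eq0 -lt0n expn_gt0 b0.
congr Num.truncn; apply: (mulIf bn0); rewrite divfK// natrX -mulrA -exprD.
by rewrite subnKC.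
Qed.

Lemma midpoint_ge0 (b k : nat) (x : R) : 0 <= midpoint b k x.
Proof. by rewrite /midpoint divr_ge0 ?exprn_ge0// addr_ge0. Qed.

Lemma truncn_midpoint (b k : nat) (x : R) : (0 < b)%N ->
  Num.truncn (midpoint b k x * b%:R ^+ k) = Num.truncn (x * b%:R ^+ k).
Proof.
move=> b0; rewrite /midpoint divfK; last by rewrite expf_neq0// pnatr_eq0 -lt0n.
by apply: truncn_def; rewrite -(natr1 (Num.truncn _)); apply/andP; split; lra.
Qed.

Lemma midpoint_midpoint (b k k' : nat) (x : R) : (0 < b)%N -> 0 <= x -> (k <= k')%N ->
  midpoint b k (midpoint b k' x) = midpoint b k x.
Proof.
move=> b0 x0 kk'; rewrite {1 3}/midpoint; congr ((_%:R + _) / _).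
rewrite (truncn_refine b0 _ kk') ?midpoint_ge0// truncn_midpoint//.
by rewrite -truncn_refine.
Qed.

Definition cell_index (s b : nat) (k : 'I_s -> nat) (x : s.-tuple R) (j : 'I_s) : nat :=
  Num.truncn (tnth x j * b%:R ^+ k j).

Definition cell_center (s b : nat) (k : 'I_s -> nat) (c : 'I_s -> nat) : s.-tuple R :=
  [tuple ((c j)%:R + 2^-1) / b%:R ^+ k j | j < s].

Lemma cell_center_index (s b : nat) (k c : 'I_s -> nat) (x : s.-tuple R) :
    (forall j, cell_index b k x j = c j) ->
  cell_center b k c = [tuple midpoint b (k j) (tnth x j) | j < s].
Proof.
move=> h; apply: eq_from_tnth => j; rewrite !tnth_mktuple /midpoint.
by rewrite -/(cell_index b k x j) h.
Qed.

(** The center of a cell at finer levels [k'] has the same midpoints as [x] at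
    the levels [k], hence the same increments. *)
Lemma mixed_increment_cell (s b m : nat) (x : s.-tuple R) (k k' c : 'I_s -> nat) l G u :
    (0 < b)%N -> (forall j, 0 <= tnth x j) ->
    (forall j, k j <= k' j)%N -> (forall j, k j <= m)%N ->
    (forall j, cell_index b k' x j = c j) ->
  mixed_increment b m (cell_center b k' c) k l G u = mixed_increment b m x k l G u.
Proof.
move=> b0 x0 kk' km xc; rewrite (cell_center_index xc).
elim: l u => //= j l IH u; rewrite !IH !tnth_mktuple /node km.
have km' : ((k j).-1 <= m)%N by exact: leq_trans (leq_pred _) (km j).
have kk'' : ((k j).-1 <= k' j)%N by exact: leq_trans (leq_pred _) (kk' j).
by rewrite km' !midpoint_midpoint.
Qed.
End Cells.

(** * Scrambling and elementary intervals *)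

Section ScrambledCells.
Context {R : realType} (b : nat) (b0 : (0 < b)%N).
Implicit Types (pi : seq 'I_b -> {perm 'I_b}) (x y : R) (k n : nat).

Definition last_digit n : 'I_b := Ordinal (ltn_pmod n b0).

Fixpoint digit_word k n : seq 'I_b :=
  if k is k'.+1 then rcons (digit_word k' (n %/ b)) (last_digit n) else [::].

(** The action of the scrambling on the cells of level [k], a cell being
    numbered by the integer whose base [b] digits are the leading digits of its
    points. *)
Fixpoint scramble_cell pi k n : nat :=
  if k is k'.+1 then
    (scramble_cell pi k' (n %/ b) * b + pi (digit_word k' (n %/ b)) (last_digit n))%N
  else 0%N.

Lemma scramble_cell_lt pi k n : (scramble_cell pi k n < b ^ k)%N.
Proof.
elim: k n => [|k IH] n //=; have := IH (n %/ b)%N.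
have := ltn_ord (pi (digit_word k (n %/ b)) (last_digit n)).
rewrite expnSr; set p := nat_of_ord _; set q := scramble_cell _ _ _ => pb qb.
apply: (@leq_trans ((q.+1) * b)); last by rewrite leq_mul2r qb orbT.
by rewrite mulSn addnC ltn_add2r.
Qed.

Lemma scramble_cell_inj pi k : {in gtn (b ^ k)%N &, injective (scramble_cell pi k)}.
Proof.
elim: k => [|k IH] n n'; rewrite !inE; first by rewrite expn0 !ltnS !leqn0 => /eqP-> /eqP->.
rewrite expnSr => nb nb' /= h.
have modp (p q p' q' : nat) : (p < b)%N -> (p' < b)%N ->
    (q * b + p = q' * b + p')%N -> (q = q' /\ p = p')%N.
  move=> pb pb' e; split.
    by have := congr1 (divn^~ b) e; rewrite /= !divnMDl// !divn_small// !addn0.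
  by have := congr1 (modn^~ b) e; rewrite /= !modnMDl !modn_small.
have [hq hp] := modp _ _ _ _ (ltn_ord _) (ltn_ord _) h.
have nn' : (n %/ b = n' %/ b)%N by apply: IH => //; rewrite inE ltn_divLR.
rewrite (divn_eq n b) (divn_eq n' b) nn'; congr (_ + _)%N.
by move/val_inj: hp; rewrite nn' => /perm_inj /(congr1 val).
Qed.

Lemma digit_wordE x k : 0 <= x ->
  [seq digit b0 x l | l <- iota 0 k] = digit_word k (Num.truncn (x * b%:R ^+ k)).
Proof.
move=> x0; elim: k => // k IH.
rewrite -[k.+1 in LHS]addn1 iotaD map_cat IH add0n cats1 /=.
by rewrite (@truncn_refine R b k k.+1 x)// subSnn expn1.
Qed.

Let scramble_term pi x k : R :=
  (pi [seq digit b0 x l | l <- iota 0 k] (digit b0 x k))%:R / b%:R ^+ k.+1.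

Lemma series_scramble pi x k : 0 <= x ->
  series (scramble_term pi x) k =
  (scramble_cell pi k (Num.truncn (x * b%:R ^+ k)))%:R / b%:R ^+ k.
Proof.
move=> x0; have b0' : b%:R != 0 :> R by rewrite pnatr_eq0 -lt0n.
elim: k => [|k IH]; first by rewrite /series /= big_geq// mul0r.
have e : (Num.truncn (x * b%:R ^+ k.+1) %/ b)%N = Num.truncn (x * b%:R ^+ k).
  by rewrite (truncn_refine b0 x0 (leqnSn k)) subSnn expn1.
rewrite seriesSr IH /scramble_term digit_wordE//= e natrD natrM mulrDl.
by congr (_ + _); rewrite exprS invfM mulrA mulfK.
Qed.

(** The partial sum of order [k] of the scrambled expansion is the left end of
    the image cell, and the remainder is at most the length of a cell. *)
Lemma scramble_coord_itv pi x k : 0 <= x ->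
  (scramble_cell pi k (Num.truncn (x * b%:R ^+ k)))%:R / b%:R ^+ k
    <= scramble_coord b0 pi x
    <= (scramble_cell pi k (Num.truncn (x * b%:R ^+ k))).+1%:R / b%:R ^+ k.
Proof.
move=> x0; have b0' : 0 < b%:R :> R by rewrite ltr0n.
have bk n : 0 < b%:R ^+ n :> R by rewrite exprn_gt0.
pose f := scramble_term pi x; have f0 n : 0 <= f n by rewrite divr_ge0// ltW.
have f1 n : f n + b%:R ^- n.+1 <= b%:R ^- n.
  rewrite /f /scramble_term -[X in _ + X]mul1r -mulrDl ler_pdivrMr// exprSr mulKf ?gt_eqF//.
  by rewrite natr1 ler_nat ltn_ord.
have nd : nondecreasing_seq (series f).
  by apply/nondecreasing_seqP => n; rewrite seriesSr lerDl.
have ni : nonincreasing_seq (fun n => series f n + b%:R ^- n).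
  by apply/nonincreasing_seqP => n; rewrite seriesSr -addrA lerD2l.
have cv : cvgn (series f).
  apply: nondecreasing_is_cvgn => //; exists 1 => _ [n _ <-].
  apply: (@le_trans _ _ (series f n + b%:R ^- n)); first by rewrite lerDl invr_ge0 ltW.
  have s0 : series f 0%N = 0 by rewrite /series /= big_geq.
  by have := ni 0%N n (leq0n n); rewrite s0 add0r expr0 invr1.
rewrite -series_scramble// -natr1 mulrDl mul1r -series_scramble//.
apply/andP; split; first exact: nondecreasing_cvgn_le.
apply: limr_le => //; near=> n.
have kn : (k <= n)%N by near: n; exact: nbhs_infty_ge.
apply: le_trans (ni k n kn); by rewrite lerDl invr_ge0 ltW.
Unshelve. all: by end_near. Qed.

Lemma truncn_scramble pi x k : 0 <= x ->
    (forall c : nat, scramble_coord b0 pi x != c%:R / b%:R ^+ k) ->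
  Num.truncn (scramble_coord b0 pi x * b%:R ^+ k) =
  scramble_cell pi k (Num.truncn (x * b%:R ^+ k)).
Proof.
move=> x0 hc; have /andP[h1 h2] := scramble_coord_itv pi k x0.
have bk : 0 < b%:R ^+ k :> R by rewrite exprn_gt0// ltr0n.
by apply: truncn_def; rewrite -ler_pdivrMr// h1 -ltr_pdivlMr// lt_neqAle h2 hc.
Qed.
End ScrambledCells.

Section NetCounts.
Context {R : realType} {s : nat}.
Implicit Types (p a u : nat -> s.-tuple R) (k c : 'I_s -> nat).

Definition net_counts (b t m : nat) p := forall k c,
  (forall j, (c j < b ^ k j)%N) -> (\sum_j k j = m - t)%N ->
  #|[set i : 'I_(b ^ m)%N | [forall j, cell_index b k (p i) j == c j]]%SET| = (b ^ t)%N.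

(** Off the faces of the grid of step [b ^- m], and in particular off the
    expansions with infinitely many digits [b - 1], a point lies in the interior
    of its cells. *)
Definition off_grid (b m : nat) (y : R) :=
  0 < y < 1 /\ forall c : nat, y != c%:R / b%:R ^+ m.

Lemma off_grid_coarser (b m k : nat) (y : R) : (0 < b)%N -> (k <= m)%N -> off_grid b m y ->
  forall c : nat, y != c%:R / b%:R ^+ k.
Proof.
move=> b0 km [_ h] c; apply: contra (h (c * b ^ (m - k))%N) => /eqP->.
have b0' : b%:R != 0 :> R by rewrite pnatr_eq0 -lt0n.
have -> : b%:R ^+ m = b%:R ^+ (m - k) * b%:R ^+ k :> R by rewrite -exprD subnK.
by apply/eqP; rewrite natrM natrX invfM mulrA mulfK// expf_neq0.
Qed.

Lemma net_counts_ts_net (b t m : nat) p : (0 < b)%N ->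
  ts_net t (fun i : 'I_(b ^ m)%N => p i) -> net_counts b t m p.
Proof.
move=> b0 [tm p01 h] k c cb sk; rewrite -(h k c) //; last first.
  by rewrite /elementary_volume prodfV prodrXr sk.
apply: eq_card => i; rewrite !inE; apply: eq_forallb => j.
have /andP[pj0 _] := p01 i j; have bk : 0 < b%:R ^+ k j :> R by rewrite exprn_gt0// ltr0n.
rewrite truncn_eq; last by rewrite mulr_ge0// ltW.
by rewrite ler_pdivrMr// ltr_pdivlMr.
Qed.

(** Scrambling permutes the cells of each level, so it preserves the number of
    points per cell. *)
Lemma net_counts_scrambling (b t m : nat) (b0 : (0 < b)%N) (a u : nat -> s.-tuple R) pi :
    owen_scrambling b0 a u pi -> ts_net t (fun i : 'I_(b ^ m)%N => a i) ->
    (forall (i : 'I_(b ^ m)%N) j, off_grid b m (tnth (u i) j)) ->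
  net_counts b t m u.
Proof.
move=> ua anet ugrid k c cb sk.
have km j : (k j <= m)%N.
  apply: (@leq_trans (m - t)); last exact: leq_subr.
  by rewrite -sk (bigD1 j)//= leq_addr.
have cellE (i : 'I_(b ^ m)%N) j : cell_index b k (u i) j =
    scramble_cell b0 (pi j) (k j) (cell_index b k (a i) j).
  have [_ a01 _] := anet; have /andP[a0 _] := a01 i j.
  rewrite /cell_index ua truncn_scramble// -ua.
  exact: off_grid_coarser (ugrid i j).
pose sigma j (n : 'I_(b ^ k j)) : 'I_(b ^ k j) :=
  Ordinal (scramble_cell_lt b0 (pi j) (k j) n).
have sigma_inj j : injective (sigma j).
  move=> n n' /(congr1 val) /= h; apply/val_inj.
  by apply: scramble_cell_inj h; rewrite inE ltn_ord.
pose c' j : nat := invF (sigma_inj j) (Ordinal (cb j)).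
rewrite -(@net_counts_ts_net b t m a b0 anet k c' (fun j => ltn_ord _) sk).
apply: eq_card => i; rewrite !inE; apply: eq_forallb => j; rewrite cellE.
have aj : (cell_index b k (a i) j < b ^ k j)%N.
  by have [_ a01 _] := anet; exact: truncn_cell.
have -> : scramble_cell b0 (pi j) (k j) (cell_index b k (a i) j) =
    sigma j (Ordinal aj) by [].
have cE : sigma j (invF (sigma_inj j) (Ordinal (cb j))) = Ordinal (cb j) by exact: f_invF.
apply/eqP/eqP => [h|h].
  have /(congr1 (invF (sigma_inj j))) : sigma j (Ordinal aj) = Ordinal (cb j) by exact/val_inj.
  by rewrite invF_f => /(congr1 val).
have -> : Ordinal aj = invF (sigma_inj j) (Ordinal (cb j)) by exact/val_inj.
by rewrite cE.
Qed.
End NetCounts.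

(** * Integration over the cube *)

Section CubeIntegral.
Context {R : realType}.
Local Open Scope ereal_scope.

Lemma measurable_prod_coord s (f : 'I_s -> R -> R) :
  (forall j, measurable_fun [set: R] (f j)) ->
  measurable_fun [set: s.-tuple R] (fun x : s.-tuple R => (\prod_j f j (tnth x j))%R).
Proof.
move=> mf; apply: measurable_prod => j _.
by apply: measurableT_comp => //; exact: measurable_tnth.
Qed.

(** Fubini for products of functions of one coordinate. *)
Lemma integral_cube_prod s (f : 'I_s -> R -> R) (v : 'I_s -> R) :
    (forall j, measurable_fun [set: R] (f j)) -> (forall j x, 0 <= f j x)%R ->
    (forall j, \int[uniform_prob (@ltr01 R)]_x (f j x)%:E = (v j)%:E) ->
  \int[cube_prob s]_x (\prod_j f j (tnth x j))%:E = (\prod_j v j)%:E.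
Proof.
elim: s f v => [|s IH] f v mf f0 fv.
  rewrite big_ord0 /=; under eq_integral do rewrite big_ord0.
  by rewrite integral_cst//= diracT mule1.
have mg := measurable_prod_coord mf.
have g0 (x : s.+1.-tuple R) : (0 <= \prod_j f j (tnth x j))%R by apply: prodr_ge0.
pose phi (p : measurableTypeR R * s.-tuple R) : s.+1.-tuple R := [tuple of (p.1 : R) :: p.2].
have mphi : measurable_fun setT phi.
  apply: (@measurable_cons _ _ _ R (fun p => p.1) s (fun p => p.2)).
    exact: (@measurable_fst _ _ (measurableTypeR R) (s.-tuple R)).
  exact: measurable_snd.
transitivity (\int[uniform_prob (@ltr01 R) \x cube_prob s]_p
    ((fun x : s.+1.-tuple R => (\prod_j f j (tnth x j))%:E) \o phi) p).
  apply: (@ge0_integral_pushforward _ _ _ _ R phi mphi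
    (uniform_prob (@ltr01 R) \x cube_prob s) setT) => //.
  - exact/measurable_EFinP.
  - by move=> y _; rewrite lee_fin.
rewrite fubini_tonelli1; first last.
- by move=> p; rewrite lee_fin.
- by apply: measurableT_comp => //; exact/measurable_EFinP.
have V0 : (0 <= \prod_(j < s) v (lift ord0 j))%R.
  rewrite -lee_fin -(IH (fun j => f (lift ord0 j)) (fun j => v (lift ord0 j)))//.
  by apply: integral_ge0 => x _; rewrite lee_fin; apply: prodr_ge0.
transitivity (\int[uniform_prob (@ltr01 R)]_x
    ((\prod_(j < s) v (lift ord0 j))%:E * (f ord0 x)%:E)).
  apply: eq_integral => x _; rewrite /fubini_F /=.
  under eq_integral => y _.
    rewrite big_ord_recl /= EFinM.
    have -> : tnth (phi (x, y)) ord0 = x by rewrite (tnth_nth 0%R).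
    have -> : (\prod_(i < s) f (lift ord0 i) (tnth (phi (x, y)) (lift ord0 i)) =
      \prod_(i < s) f (lift ord0 i) (tnth y i))%R.
      by apply: eq_bigr => i _; congr (f _ _); rewrite !(tnth_nth 0%R).
    over.
  rewrite ge0_integralZl//.
  - by rewrite (IH (fun j => f (lift ord0 j)) (fun j => v (lift ord0 j)))// muleC.
  - by apply/measurable_EFinP; exact: (measurable_prod_coord (fun j => mf (lift ord0 j))).
  - by move=> y _; rewrite lee_fin; apply: prodr_ge0.
  - by rewrite lee_fin.
rewrite ge0_integralZl// ?lee_fin//.
- by rewrite fv -EFinM big_ord_recl mulrC.
- by apply/measurable_EFinP; exact: mf.
- by move=> x _; rewrite lee_fin.
Qed.

Lemma measurable_box s (S : 'I_s -> set R) : (forall j, measurable (S j)) ->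
  measurable [set x : s.-tuple R | forall j, S j (tnth x j)].
Proof.
move=> mS; have -> : [set x : s.-tuple R | forall j, S j (tnth x j)] =
    \bigcap_(j in [set: 'I_s]) ((fun x : s.-tuple R => tnth x j) @^-1` S j).
  by apply/seteqP; split => x h j => [_|]; [exact: h | exact: h j I].
apply: fin_bigcap_measurable => // j _.
by rewrite -[X in measurable X]setTI; exact: measurable_tnth.
Qed.

Lemma cube_prob_box s (S : 'I_s -> set R) (v : 'I_s -> R) :
    (forall j, measurable (S j)) ->
    (forall j, uniform_prob (@ltr01 R) (S j) = (v j)%:E) ->
  cube_prob s [set x | forall j, S j (tnth x j)] = (\prod_j v j)%:E.
Proof.
move=> mS Sv; have mB := measurable_box mS.
rewrite -(setIT [set x | _]) -integral_indic//.
rewrite -(@integral_cube_prod s (fun j => \1_(S j)) v).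
- apply: eq_integral => x _; congr EFin; rewrite indicE.
  have [xS|xS] := pselect (forall j, S j (tnth x j)).
    by rewrite mem_set// big1// => j _; rewrite indicE mem_set.
  rewrite memNset//; apply/esym; move/existsNP: xS => [j xj].
  by rewrite (bigD1 j)//= indicE memNset// mul0r.
- by move=> j; exact: measurable_indic.
- by move=> j x; rewrite indicE.
- by move=> j; rewrite integral_indic//; [rewrite setIT; exact: Sv | exact: mS].
Qed.

Lemma uniform_probE (S : set R) : measurable S ->
  uniform_prob (@ltr01 R) S = lebesgue_measure (S `&` `[0%R, 1%R]).
Proof.
move=> mS; rewrite -[in LHS](setIT S) -[LHS]integral_indic//.
rewrite integral_uniform//.
- by rewrite subr0 invr1 mul1e integral_indic.
- by apply/measurable_EFinP; exact: measurable_indic.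
Qed.
End CubeIntegral.

Section OneDimMeasure.
Context {R : realType}.
Local Open Scope ereal_scope.

Definition cell_itv (b k c : nat) : set R :=
  `[(c%:R / b%:R ^+ k)%R, (c.+1%:R / b%:R ^+ k)%R[%classic.

Lemma measurable_cell_itv b k c : measurable (cell_itv b k c).
Proof. exact: measurable_itv. Qed.

Lemma uniform_prob_cell b k c : (0 < b)%N -> (c < b ^ k)%N ->
  uniform_prob (@ltr01 R) (cell_itv b k c) = (b%:R ^- k)%:E.
Proof.
move=> b0 ck; have bk : (0 < b%:R ^+ k :> R)%R by rewrite exprn_gt0 // ltr0n.
have c0 : (0 <= c%:R / b%:R ^+ k :> R)%R by rewrite divr_ge0// ltW.
have c1 : (c.+1%:R / b%:R ^+ k <= 1 :> R)%R.
  by rewrite ler_pdivrMr// mul1r -natrX ler_nat.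
rewrite uniform_probE; last exact: measurable_cell_itv.
rewrite (_ : _ `&` _ = cell_itv b k c).
  rewrite /cell_itv lebesgue_measure_itv/= lte_fin ltr_pM2r ?invr_gt0// ltr_nat leqnn.
  by rewrite -EFinB -mulrBl -natr1 addrAC subrr add0r mul1r.
apply/setIidPl => x; rewrite /cell_itv /= !in_itv /= => /andP[h1 h2].
by rewrite (le_trans c0 h1) (ltW (lt_le_trans h2 c1)).
Qed.

Lemma measurable_off_grid b m : measurable [set y : R | off_grid b m y].
Proof.
have -> : [set y : R | off_grid b m y] =
    `]0%R, 1%R[%classic `\` range (fun c : nat => c%:R / b%:R ^+ m : R)%R.
  apply/seteqP; split => y /=; rewrite /off_grid in_itv /=.
    by move=> [y01 yc]; split => // -[c _ cy]; move: (yc c); rewrite cy eqxx.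
  by move=> [y01 yc]; split => // c; apply/eqP => cy; apply: yc; exists c.
apply: measurableD; first exact: measurable_itv.
by apply: countable_measurable; [move=> r; exact: measurable_set1 | exact: card_image_le].
Qed.

Lemma uniform_prob_off_grid b m : (0 < b)%N ->
  uniform_prob (@ltr01 R) [set y : R | off_grid b m y] = 1.
Proof.
move=> b0; have b0' : b%:R != 0%R :> R by rewrite pnatr_eq0 -lt0n.
set grid : set R := range (fun c : nat => c%:R / b%:R ^+ m : R)%R.
have grid0 : lebesgue_measure grid = 0.
  by apply: countable_lebesgue_measure0; exact: card_image_le.
have mgrid : measurable grid.
  by apply: countable_measurable; [move=> r; exact: measurable_set1 | exact: card_image_le].
rewrite uniform_probE; last exact: measurable_off_grid.
set S := _ `&` _.
have mS : measurable S by apply: measurableI; [exact: measurable_off_grid|exact: measurable_itv].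
have gS0 : lebesgue_measure (grid `&` `[0%R, 1%R]%classic) = 0.
  by apply: (subset_measure0 _ _ _ grid0) => //; apply: measurableI => //; exact: measurable_itv.
have mgS : measurable (grid `&` `[0%R, 1%R]%classic).
  by apply: measurableI => //; exact: measurable_itv.
rewrite -(@measureU0 _ _ _ (@lebesgue_measure R) S _ mS mgS gS0) -setIUl (_ : _ `&` _ = `[0%R, 1%R]%classic).
  by have := @lebesgue_measure_itv R `[0%R, 1%R]; rewrite /= lte_fin ltr01 oppr0 adde0.
apply/setIidPr => y /=; rewrite in_itv /= => /andP[y0 y1].
have [|ngrid] := pselect (grid y); first by right.
left; split.
  rewrite !lt_neqAle y0 y1 !andbT; apply/andP; split; apply/eqP => e; apply: ngrid.
    by exists 0%N => //; rewrite mul0r.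
  by exists (b ^ m)%N => //; rewrite natrX mulfV// expf_neq0.
by move=> c; apply/eqP => e; apply: ngrid; exists c.
Qed.

Lemma measurable_edge_powR (p : R) : measurable_fun [set: R] (fun x => edge x `^ p)%R.
Proof.
have me : measurable_fun [set: R] (@edge R).
  have -> : @edge R = (id \min (fun x : R => 1 - x)%R) by [].
  by apply: measurable_minr => //; exact: measurable_funB.
exact: (@measurableT_comp _ _ _ R R R (fun x => x `^ p)%R setT (@edge R) (@measurable_powR R p) me).
Qed.

(** Dyadic shells: on the shell at distance about [2 ^- l] from the edges the
    function is of order [2 ^ (p l)] and the shell has measure of order
    [2 ^- l]. *)
Lemma edge_powRN_integral (p : R) : (0 < p < 1)%R ->
  exists V : R, \int[uniform_prob (@ltr01 R)]_x (edge x `^ (- p))%:E = V%:E.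
Proof.
move=> /andP[p0 p1]; pose q : R := (2 `^ p)%R.
have q0 : (0 < q)%R by rewrite powR_gt0.
have q2 : (q < 2)%R.
  rewrite /q -[ltRHS](@powRr1 _ 2)//; rewrite /powR !gt_eqF// ltr_expR.
  by rewrite ltr_pM2r// ln_gt0// ltr1n.
pose A l : set R := `[0%R, 2 ^- l]%classic `|` `[(1 - 2 ^- l)%R, 1%R]%classic.
have mA l : measurable (A l) by apply: measurableU; exact: measurable_itv.
have muA l : lebesgue_measure (A l) <= (2 * 2 ^- l)%:E.
  have l0 : (0 < 2 ^- l :> R)%R by rewrite invr_gt0 exprn_gt0.
  apply: (@le_trans _ _ (lebesgue_measure (`[0%R, 2 ^- l]%classic : set R) +
     lebesgue_measure (`[(1 - 2 ^- l)%R, 1%R]%classic : set R))).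
    by apply: measureU2; exact: measurable_itv.
  rewrite !lebesgue_measure_itv /= !lte_fin l0 ltrBlDl ltrDr l0 -!EFinB -EFinD lee_fin.
  by rewrite le_eqVlt; apply/orP; left; apply/eqP; ring.
pose f l (x : R) : \bar R := (q ^+ l.+1 * \1_(A l) x)%:E.
have f0 l x : 0 <= f l x by rewrite lee_fin mulr_ge0 ?exprn_ge0 ?(ltW q0)// indicE.
have mf l : measurable_fun [set: R] (f l).
  by apply/measurable_EFinP; apply: measurable_funM => //; exact: measurable_indic.
have le_shell (x : R) : (0 <= x <= 1)%R -> (edge x `^ (- p))%:E <= \sum_(0 <= l <oo) f l x.
  move=> /andP[x0 x1]; have e0 : (0 <= edge x)%R by rewrite le_min x0 subr_ge0.
  have [->|ne0] := eqVneq (edge x) 0%R.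
    rewrite powR0 ?oppr_eq0 ?gt_eqF//; apply: nneseries_ge0 => *; exact: f0.
  have {ne0}e0 : (0 < edge x)%R by rewrite lt_neqAle eq_sym ne0.
  have einv1 : (1 <= (edge x)^-1)%R by rewrite invf_ge1// edge_le1.
  pose N := Num.truncn (edge x)^-1.
  have N0 : (0 < N)%N by rewrite truncn_gt0.
  have /truncn_itv/andP[N1 N2] : (0 <= (edge x)^-1)%R by rewrite invr_ge0 ltW.
  pose l := trunc_log 2 N.
  have /andP[l1 l2] : (2 ^ l <= N < 2 ^ l.+1)%N by exact: trunc_log_bounds.
  have el : (edge x <= 2 ^- l)%R.
    rewrite -[leLHS]invrK lef_pV2 ?posrE ?invr_gt0 ?exprn_gt0//.
    by apply: le_trans N1; rewrite -natrX ler_nat.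
  have el' : (2 ^- l.+1 <= edge x)%R.
    rewrite -[leRHS]invrK lef_pV2 ?posrE ?invr_gt0 ?exprn_gt0//.
    by apply: le_trans (ltW N2) _; rewrite -natrX ler_nat.
  apply: (@le_trans _ _ (f l x)); last first.
    apply: le_trans (@nneseries_lim_ge _ (f ^~ x) predT 0 l.+1 _); last by [].
    by rewrite big_nat_recr//= leeDr// sume_ge0.
  rewrite /f indicE mem_set ?mulr1 ?lee_fin; last first.
    rewrite /A /= !in_itv /=; move: el; rewrite /edge ge_min => /orP[h|h].
      by left; rewrite x0 h.
    by right; rewrite x1 andbT lerBlDl -lerBlDr.
  apply: (@le_trans _ _ ((2 ^- l.+1) `^ (- p))%R).
    by apply: powR_antitone => //; rewrite ?(ltW p0)// invr_gt0 exprn_gt0.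
  rewrite -[X in (X `^ _)%R](powR_invn)// -powRrM mulNr mulrN opprK mulrC powRrM.
  by rewrite powR_mulrn// ltW.
have mfs l : measurable_fun (`[0%R, 1%R]%classic : set R) (f l) by exact: measurable_funTS.
have intf l : \int[lebesgue_measure]_(x in `[0%R, 1%R]) f l x <= ((2 * q) * (q / 2) ^+ l)%:E.
  have -> : \int[lebesgue_measure]_(x in `[0%R, 1%R]) f l x =
      (q ^+ l.+1)%:E * lebesgue_measure (A l `&` `[0%R, 1%R]).
    transitivity ((q ^+ l.+1)%:E * \int[lebesgue_measure]_(x in `[0%R, 1%R]) (\1_(A l) x)%:E).
      apply: (@integralZl_indic _ (measurableTypeR R) R lebesgue_measure _ _ (fun=> A l)).
      - exact: measurable_itv.
      - by rewrite ltNge exprn_ge0// ltW.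
      - exact: mA.
    by congr (_ * _); apply: integral_indic; [exact: measurable_itv | exact: mA].
  apply: (@le_trans _ _ ((q ^+ l.+1)%:E * (2 * 2 ^- l)%:E)).
    rewrite lee_pmul2l ?lte_fin ?exprn_gt0//; apply: le_trans (muA l).
    apply: le_measure; [apply/mem_set|apply/mem_set; exact: mA|exact: subIsetl].
    by apply: measurableI; [exact: mA | exact: measurable_itv].
  by rewrite -EFinM lee_fin exprS expr_div_n le_eqVlt; apply/orP; left; apply/eqP; ring.
pose C : R := (2 * q / (1 - q / 2))%R.
have intC : \int[uniform_prob (@ltr01 R)]_x (edge x `^ (- p))%:E <= C%:E.
  rewrite integral_uniform; first last.
  - by move=> x; rewrite lee_fin powR_ge0.
  - by apply/measurable_EFinP; exact: measurable_edge_powR.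
  rewrite subr0 invr1 mul1e.
  apply: (@le_trans _ _ (\int[lebesgue_measure]_(x in `[0%R, 1%R]) \sum_(0 <= l <oo) f l x)).
    apply: ge0_le_integral => //.
    - by move=> x _; rewrite lee_fin powR_ge0.
    - by apply: measurable_funTS; apply/measurable_EFinP; exact: measurable_edge_powR.
    - by apply: ge0_emeasurable_sum => [l x _ _|l _]; [exact: f0 | exact: mfs].
  rewrite integral_nneseries//.
  apply: lime_le; first by apply: is_cvg_nneseries => *; exact: integral_ge0.
  apply: nearW => n; apply: (@le_trans _ _ (\sum_(0 <= l < n) ((2 * q) * (q / 2) ^+ l)%:E)).
    by apply: lee_sum => l _; exact: intf.
  rewrite sumEFin lee_fin.
  have z1 : (q / 2 != 1)%R by lra.
  have := geometric_seriesE (2 * q) z1 => /(congr1 (fun g : R^nat => g n)) /=.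
  rewrite /series /= => ->; rewrite /C ler_pM2r ?invr_gt0; last lra.
  by rewrite ler_piMr ?mulr_ge0 ?(ltW q0)// lerBlDr lerDl exprn_ge0// divr_ge0// ltW.
have int0 : 0 <= \int[uniform_prob (@ltr01 R)]_x (edge x `^ (- p))%:E.
  by apply: integral_ge0 => x _; rewrite lee_fin powR_ge0.
exists (fine (\int[uniform_prob (@ltr01 R)]_x (edge x `^ (- p))%:E)).
rewrite fineK// fin_real// (le_lt_trans intC) ?ltry// andbT.
by rewrite (lt_le_trans _ int0).
Qed.
End OneDimMeasure.

(** * Functions that nets integrate exactly *)

Section NetExact.
Context {R : realType} {s : nat} (b t m : nat).
Hypotheses (b0 : (0 < b)%N) (tm : (t <= m)%N).
Implicit Types (E G : s.-tuple R -> R) (x u : s.-tuple R) (k c : 'I_s -> nat).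

Local Notation mu := (@cube_prob R s).

Definition grid_free : set (s.-tuple R) := [set x | forall j, off_grid b m (tnth x j)].

Lemma measurable_grid_free : measurable grid_free.
Proof.
exact: (@measurable_box R s (fun=> [set y | off_grid b m y]) (fun=> @measurable_off_grid R b m)).
Qed.
Hint Resolve measurable_grid_free : core.

Lemma cube_prob_grid_free : mu grid_free = 1%E.
Proof.
rewrite (@cube_prob_box R s (fun=> [set y | off_grid b m y]) (fun=> 1)).
- by rewrite big1.
- by move=> j; exact: measurable_off_grid.
- by move=> j; exact: (@uniform_prob_off_grid R b m b0).
Qed.

Lemma grid_free_open_cube : grid_free `<=` open_cube.
Proof. by move=> x xD j; case: (xD j). Qed.

Lemma cube_prob_grid_freeC : mu (~` grid_free) = 0%E.
Proof. by rewrite probability_setC// cube_prob_grid_free subee. Qed.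

Lemma integral_grid_free (f : s.-tuple R -> \bar R) : measurable_fun setT f ->
  (forall x, 0 <= f x)%E -> (\int[mu]_x f x = \int[mu]_(x in grid_free) f x)%E.
Proof.
move=> mf f0.
rewrite (@ge0_negligible_integral _ _ _ mu setT (~` grid_free))//.
- by rewrite setTD setCK.
- exact: measurableC.
- exact: cube_prob_grid_freeC.
Qed.

(** One value [v] serves the integral and all nets at once; in this form the
    property is linear in [E]. *)
Definition net_exact E :=
  mu.-integrable grid_free (EFin \o E) /\
  exists2 v, (\int[mu]_(x in grid_free) (E x)%:E = v%:E)%E &
    forall p : nat -> s.-tuple R, (forall i : 'I_(b ^ m)%N, grid_free (p i)) ->
      net_counts b t m p -> (b ^ m)%:R^-1 * \sum_(i < b ^ m) E (p i) = v.

Lemma net_exactD E E' : net_exact E -> net_exact E' -> net_exact (fun x => E x + E' x).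
Proof.
move=> [iE [v Ev hv]] [iE' [v' Ev' hv']]; split.
  have -> : EFin \o (fun x => E x + E' x) = ((EFin \o E) \+ (EFin \o E'))%E by [].
  by apply: (integrableD measurable_grid_free iE).
exists (v + v').
  by rewrite EFinD -Ev -Ev' -[RHS](integralD_EFin measurable_grid_free iE iE').
by move=> p pD pn; rewrite big_split mulrDr hv// hv'.
Qed.

Lemma net_exactZ (a : R) E : net_exact E -> net_exact (fun x => a * E x).
Proof.
move=> [iE [v Ev hv]]; split; first exact: (integrableZl measurable_grid_free a iE).
exists (a * v).
  by rewrite EFinM -Ev -[RHS](integralZl measurable_grid_free iE).
by move=> p pD pn; rewrite -mulr_sumr mulrCA hv.
Qed.

Lemma net_exact0 : net_exact (fun=> 0).
Proof.
split; first exact: integrable0.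
exists 0; first by rewrite integral0.
by move=> p _ _; rewrite big1// mulr0.
Qed.

Lemma net_exact_sum (I : Type) (r : seq I) (Q : pred I) (E : I -> s.-tuple R -> R) :
  (forall i, Q i -> net_exact (E i)) -> net_exact (fun x => \sum_(i <- r | Q i) E i x).
Proof.
move=> hE; elim: r => [|i r IH].
  by have -> : (fun x => \sum_(i <- [::] | Q i) E i x) = (fun=> 0);
    [apply/funext => x; rewrite big_nil | exact: net_exact0].
have -> : (fun x => \sum_(i <- i :: r | Q i) E i x) =
    (fun x => (if Q i then E i x else 0) + \sum_(i <- r | Q i) E i x).
  by apply/funext => x; rewrite big_cons; case: ifP => // _; rewrite add0r.
apply: net_exactD => //.
by move: (hE i); case: (Q i) => [h|_]; [exact: h | exact: net_exact0].
Qed.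

Definition cell_box k c : set (s.-tuple R) :=
  [set x | forall j, cell_itv b (k j) (c j) (tnth x j)].

Lemma cell_boxE k c x : open_cube x -> (x \in cell_box k c) = [forall j, cell_index b k x j == c j].
Proof.
move=> cx; have eqv j : cell_itv b (k j) (c j) (tnth x j) <-> cell_index b k x j = c j.
  have /andP[x0 _] := cx j; have bk : 0 < b%:R ^+ k j :> R by rewrite exprn_gt0// ltr0n.
  have xb : 0 <= tnth x j * b%:R ^+ k j by rewrite mulr_ge0 ?ltW.
  rewrite /cell_itv /= in_itv /= ler_pdivrMr// ltr_pdivlMr// /cell_index.
  have := truncn_eq (c j) xb => <-; split => [/eqP|->] //.
apply/idP/forallP => [|h].
  by rewrite inE => h j; apply/eqP/eqv; exact: h.
by rewrite inE => j; apply/eqv/eqP.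
Qed.

Lemma net_exact_cell k c : (forall j, (c j < b ^ k j)%N) -> (\sum_j k j = m - t)%N ->
  net_exact \1_(cell_box k c).
Proof.
move=> cb sk; have mB : measurable (cell_box k c).
  by exact: (@measurable_box R s (fun j => cell_itv b (k j) (c j)) (fun j => @measurable_cell_itv R b _ _)).
split.
  apply: (@integrableS _ _ _ mu setT) => //; exact: integrable_indic.
exists (\prod_j b%:R ^- k j).
  rewrite -integral_grid_free; last by move=> x; rewrite lee_fin indicE.
    rewrite integral_indic// setIT.
    apply: (@cube_prob_box R s (fun j => cell_itv b (k j) (c j)) (fun j => b%:R ^- k j)) => j.
      exact: measurable_cell_itv.
    by apply: uniform_prob_cell.
  by apply/measurable_EFinP; exact: measurable_indic.
move=> p pD pn; rewrite prodfV prodrXr sk.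
have -> : \sum_(i < b ^ m) \1_(cell_box k c) (p i) =
    (#|[set i : 'I_(b ^ m)%N | [forall j, cell_index b k (p i) j == c j]]%SET|)%:R :> R.
  rewrite -sum1_card natr_sum [RHS]big_mkcond; apply: eq_bigr => i _.
  rewrite indicE cell_boxE; last exact/grid_free_open_cube/pD.
  by rewrite inE; case: ifP.
have e : (b ^ m)%:R = b%:R ^+ (m - t) * (b ^ t)%:R :> R by rewrite !natrX -exprD subnK.
have bt0 : (b ^ t)%:R != 0 :> R by rewrite pnatr_eq0 -lt0n expn_gt0 b0.
by rewrite pn// e invfM -mulrA mulVf ?mulr1.
Qed.
End NetExact.

(** * The error of a net *)

Section NetApproximation.
Context {R : realType} {s : nat} (b t m : nat).
Hypotheses (b2 : (2 <= b)%N) (tm : (t <= m)%N).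
Implicit Types (E G g : s.-tuple R -> R) (x u : s.-tuple R) (k c : 'I_s -> nat) (A eta : R).

Local Notation mu := (@cube_prob R s).

Let b0 : (0 < b)%N. Proof. exact: leq_trans b2. Qed.

(** For [phi] constant on the cells of levels [k] this is [phi], written as a
    combination of indicators of cells. *)
Definition cell_sum k (phi : s.-tuple R -> R) x : R :=
  \sum_(c : {ffun 'I_s -> 'I_(b ^ m)%N} | [forall j, (c j < b ^ k j)%N])
     phi (cell_center b k (fun j => c j)) * \1_(cell_box b k (fun j => c j)) x.

Lemma cell_sumE k phi x : (forall j, (k j <= m)%N) -> open_cube x ->
  cell_sum k phi x = phi (cell_center b k (cell_index b k x)).
Proof.
move=> km cx.
have ck j : (cell_index b k x j < b ^ k j)%N.
  by apply: truncn_cell => //; case/andP: (cx j) => /ltW-> ->.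
have cm j : (cell_index b k x j < b ^ m)%N.
  by apply: leq_trans (ck j) _; rewrite leq_pexp2l.
pose c0 : {ffun 'I_s -> 'I_(b ^ m)%N} := [ffun j => Ordinal (cm j)].
have cE : (fun j => nat_of_ord (c0 j)) = cell_index b k x by apply/funext => j; rewrite ffunE.
rewrite /cell_sum (bigD1 c0) /=; last first.
  by apply/forallP => j; rewrite ffunE /=; exact: ck.
rewrite cE indicE cell_boxE//.
have -> : [forall j, cell_index b k x j == cell_index b k x j] by apply/forallP.
rewrite mulr1 big1 ?addr0// => c /andP[_ cc0].
rewrite indicE cell_boxE//; case: forallP => [h|_]; last by rewrite mulr0.
case/eqP: cc0; apply/ffunP => j; apply/val_inj; rewrite ffunE /=.
by rewrite (eqP (h j)).
Qed.

Lemma net_exact_cell_sum k phi : (\sum_j k j = m - t)%N -> net_exact b t m (cell_sum k phi).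
Proof.
move=> sk; apply: net_exact_sum => c /forallP ck; apply: net_exactZ.
exact: net_exact_cell.
Qed.

Definition all_coords : seq 'I_s := rev (enum 'I_s).

Lemma mem_all_coords j : j \in all_coords.
Proof. by rewrite mem_rev mem_enum. Qed.

Lemma uniq_all_coords : uniq all_coords.
Proof. by rewrite rev_uniq enum_uniq. Qed.

Lemma sorted_all_coords : sorted (fun i j : 'I_s => (j < i)%N) all_coords.
Proof.
rewrite /all_coords rev_sorted.
by have := iota_ltn_sorted 0 s; rewrite -val_enum_ord sorted_map.
Qed.

Definition error_factor A eta : R :=
  (m.+2 ^ s)%:R * (A * node_const b ^+ s * decay b eta ^+ (m - t)).

Definition integrable_weight eta : s.-tuple R -> R := edge_weight (fun=> 1 - eta).

(** Keeping the increments of total level at most [m - t] gives a function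
    that is constant on the cells seen by the net; each of the others, of which
    there are at most [(m + 2) ^ s], is bounded at its total level. *)
Lemma net_approximation (j0 : 'I_s) g A eta : 0 < eta -> 2 * eta <= 1 -> 0 <= A ->
    growth all_coords (fun=> eta) A g ->
  exists2 E, net_exact b t m E & forall x, open_cube x ->
    `|g x - E x| <= error_factor A eta * integrable_weight eta x.
Proof.
move=> eta0 eta1 A0 hg.
pose u0 : s.-tuple R := [tuple 2^-1 | _ < s].
have cu0 : open_cube u0 by move=> j; rewrite tnth_mktuple; apply/andP; split; lra.
pose low k := (\sum_j k j <= m - t)%N.
pose inc k x := mixed_increment b m x k all_coords g u0.
(* levels of total exactly [m - t], finer than [k] *)
pose pad k (j : 'I_s) : nat := (k j + (j == j0) * (m - t - \sum_j k j))%N.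
exists (fun x => \sum_(k <- multi_levels m all_coords | low k) cell_sum (pad k) (inc k) x).
  apply: net_exact_sum => k lowk; apply: net_exact_cell_sum.
  have one_coord (X : nat) : (\sum_(j < s) (j == j0) * X)%N = X.
    by rewrite (bigD1 j0)//= eqxx mul1n big1 ?addn0// => j /negbTE ->.
  by rewrite big_split /= one_coord subnKC.
move=> x cx.
have gE : g x = \sum_(k <- multi_levels m all_coords) inc k x.
  rewrite /inc sum_mixed_increment ?uniq_all_coords//; congr g.
  by apply: eq_from_tnth => j; rewrite tnth_mktuple mem_all_coords.
have -> : \sum_(k <- multi_levels m all_coords | low k) cell_sum (pad k) (inc k) x =
    \sum_(k <- multi_levels m all_coords | low k) inc k x.
  apply: eq_bigr => k lowk.
  have kle j : (k j <= m - t)%N by apply: leq_trans lowk; rewrite (bigD1 j)//= leq_addr.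
  have pad_le j : (pad k j <= m)%N.
    apply: (@leq_trans (m - t)); last exact: leq_subr.
    rewrite /pad; case: eqP => [->|_]; last by rewrite mul0n addn0.
    rewrite mul1n -[leqRHS](subnKC lowk) leq_add2r.
    by rewrite (bigD1 j0)//= leq_addr.
  rewrite cell_sumE// /inc; apply: mixed_increment_cell => //.
  - by move=> j; case/andP: (cx j) => /ltW.
  - by move=> j; rewrite leq_addr.
  - by move=> j; apply: leq_trans (kle j) (leq_subr _ _).
rewrite gE (bigID low) /= addrAC subrr add0r.
have C0 : 0 <= node_const b :> R by have := @node_const_ge2 R b b2; lra.
have d0 : 0 <= decay b eta by rewrite powR_ge0.
have d1 : decay b eta <= 1.
  rewrite /decay -[leRHS](powRr0 b%:R); apply: ler_powR; last lra.
  by rewrite ler1n.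
have W0 : 0 <= integrable_weight eta x by rewrite ltW// edge_weight_gt0.
have inc_le k : ~~ low k ->
    `|inc k x| <= A * node_const b ^+ s * decay b eta ^+ (m - t) * integrable_weight eta x.
  move=> highk.
  have := @mixed_increment_le R s b m x k all_coords eta (fun=> eta) A g b2 eta0 eta1 A0
    cx uniq_all_coords (fun _ _ => erefl) hg u0 cu0.
  have -> : \prod_i (if i \in all_coords then increment_weight b eta x k i
      else edge (tnth u0 i) `^ (- eta)) =
      node_const b ^+ s * (decay b eta ^+ (\sum_j k j) * integrable_weight eta x).
    under eq_bigr do rewrite mem_all_coords.
    by rewrite /increment_weight big_split big_split /= prodr_const card_ord prodrXr mulrA.
  move=> h; apply: le_trans h _; rewrite -!mulrA ler_wpM2l// ler_wpM2l ?exprn_ge0//.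
  rewrite ler_wpM2r//.
  by apply: ler_wiXn2l => //; move: highk; rewrite -ltnNge => /ltnW.
apply: le_trans (ler_norm_sum _ _ _) _.
apply: (@le_trans _ _ (\sum_(k <- multi_levels m all_coords)
   A * node_const b ^+ s * decay b eta ^+ (m - t) * integrable_weight eta x)).
  rewrite big_mkcond; apply: ler_sum => k _; case: ifP => [/inc_le//|_].
  by rewrite !mulr_ge0 ?exprn_ge0.
rewrite big_const_seq count_predT size_multi_levels size_rev size_enum_ord.
by rewrite iter_addr_0 -mulr_natl /error_factor mulrA.
Qed.

Lemma measurable_integrable_weight eta :
  measurable_fun [set: s.-tuple R] (integrable_weight eta).
Proof.
exact: (@measurable_prod_coord R s (fun _ y => edge y `^ (- (1 - eta)))
          (fun=> @measurable_edge_powR R _)).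
Qed.

Lemma integrable_weight_ge0 eta x : 0 <= integrable_weight eta x.
Proof. by apply: prodr_ge0 => j _; rewrite powR_ge0. Qed.

Lemma integral_integrable_weight eta : 0 < eta < 1 -> exists2 V, 0 <= V &
  (\int[mu]_x (integrable_weight eta x)%:E = V%:E)%E.
Proof.
move=> /andP[eta0 eta1].
have [|V hV] := @edge_powRN_integral R (1 - eta); first by apply/andP; split; lra.
exists (V ^+ s).
  rewrite exprn_ge0// -lee_fin -hV; apply: integral_ge0 => y _.
  by rewrite lee_fin powR_ge0.
have := @integral_cube_prod R s (fun _ y => edge y `^ (- (1 - eta))) (fun=> V).
rewrite prodr_const card_ord => <- //.
- by move=> j; exact: measurable_edge_powR.
- by move=> j x; exact: powR_ge0.
Qed.

(** The bound depends on [g] only through the constants of its growth and is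
    therefore uniform over a class of functions with common constants. *)
Lemma sampling_error (j0 : 'I_s) g A eta V : 0 < eta -> 2 * eta <= 1 -> 0 <= A ->
    (\int[mu]_x (integrable_weight eta x)%:E = V%:E)%E ->
    measurable_fun [set: s.-tuple R] g -> growth all_coords (fun=> eta) A g ->
  exists2 I, (\int[mu]_(x in grid_free b m) (g x)%:E = I%:E)%E &
    forall p : nat -> s.-tuple R, (forall i : 'I_(b ^ m)%N, grid_free b m (p i)) ->
      net_counts b t m p ->
      `|(b ^ m)%:R^-1 * \sum_(i < b ^ m) g (p i) - I| <=
        error_factor A eta *
          ((b ^ m)%:R^-1 * \sum_(i < b ^ m) integrable_weight eta (p i) + V).
Proof.
move=> eta0 eta1 A0 hV mg hg.
have [E [iE [v Ev hv]] gE] := net_approximation j0 eta0 eta1 A0 hg.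
have mD : measurable (@grid_free R s b m) by exact: measurable_grid_free.
have mW := measurable_integrable_weight eta.
have W0 := integrable_weight_ge0 eta.
have VD : (\int[mu]_(x in grid_free b m) (integrable_weight eta x)%:E = V%:E)%E.
  by rewrite -integral_grid_free//; apply/measurable_EFinP.
have iW : mu.-integrable (grid_free b m) (EFin \o integrable_weight eta).
  apply/integrableP; split; first by apply/measurable_EFinP; exact: measurable_funTS.
  under eq_integral do rewrite gee0_abs ?lee_fin//=.
  by rewrite VD ltry.
set Lam := error_factor A eta in gE *.
have iLW : mu.-integrable (grid_free b m) (fun x => (Lam * integrable_weight eta x)%:E).
  by under eq_fun do rewrite EFinM; exact: integrableZl.
have mE : measurable_fun (grid_free b m) E.
  by apply/measurable_EFinP; have /integrableP[] := iE.
have mgE : measurable_fun (grid_free b m) (fun x => g x - E x).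
  by apply: measurable_funB => //; exact: measurable_funTS.
have igE : mu.-integrable (grid_free b m) (fun x => (g x - E x)%:E).
  have mgE' : measurable_fun (grid_free b m) (EFin \o (fun x => g x - E x)).
    by apply/measurable_EFinP.
  apply: (le_integrable mD mgE' _ iLW) => x xD; rewrite /= !lee_fin; apply: le_trans (gE x _) (ler_norm _).
  exact: grid_free_open_cube xD.
have ig : mu.-integrable (grid_free b m) (EFin \o g).
  have -> : EFin \o g = ((fun x => (g x - E x)%:E) \+ (EFin \o E))%E.
    by apply/funext => x /=; rewrite -EFinD subrK.
  exact: integrableD.
have Ig_fin := integrable_fin_num mD ig.
exists (fine (\int[mu]_(x in grid_free b m) (g x)%:E)%E); first by rewrite fineK.
set I := fine _.
have Iv : `|I - v| <= Lam * V.
  rewrite -lee_fin EFinM -VD -(integralZl mD iW).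
  have -> : (`|I - v|)%:E = `| \int[mu]_(x in grid_free b m) (g x - E x)%:E |%E.
    under eq_integral do rewrite EFinB.
    by rewrite (integralB_EFin mD ig iE) -(fineK Ig_fin) Ev -EFinB.
  apply: le_trans (le_abse_integral _ mD _) _; first by apply/measurable_EFinP.
  apply: ge0_le_integral => //.
  - by apply: measurableT_comp => //; apply/measurable_EFinP.
  - by have /integrableP[] := iLW.
  - move=> x xD; rewrite /= -EFinM lee_fin; apply: gE.
    exact: grid_free_open_cube xD.
move=> p pD pn; have vE := hv p pD pn.
have -> : (b ^ m)%:R^-1 * \sum_(i < b ^ m) g (p i) - I =
    (b ^ m)%:R^-1 * \sum_(i < b ^ m) (g (p i) - E (p i)) + (v - I).
  by rewrite sumrB mulrBr vE addrA subrK.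
apply: le_trans (ler_normD _ _) _; rewrite mulrDr lerD//; last by rewrite distrC.
rewrite normrM mulrCA ger0_norm ?invr_ge0// ler_wpM2l ?invr_ge0//.
apply: le_trans (ler_norm_sum _ _ _) _; rewrite mulr_sumr; apply: ler_sum => i _.
by apply: gE; exact/grid_free_open_cube/pD.
Qed.
End NetApproximation.

(** * The risk as an integral over the cube *)

Section RiskOfNetworks.
Context {R : realType}.

Lemma measurable_swish : measurable_fun [set: R] (@swish R).
Proof.
have ms : measurable_fun [set: R] (@sigmoid R).
  apply: continuous_measurable_fun => x.
  have [dx _] := is_derive_sigmoid (is_derive_id x (1 : R)).
  by apply: differentiable_continuous; apply/derivable1_diffP.
by apply: measurable_funM => //; exact: ms.
Qed.

Lemma measurable_affine_entry disp (T : measurableType disp) m n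
    (AB : 'M[R]_(m, n) * 'cV[R]_m) (x : T -> 'cV[R]_n) :
    (forall j, measurable_fun [set: T] (fun w => x w j 0)) ->
  forall i, measurable_fun [set: T] (fun w => affine AB (x w) i 0).
Proof.
move=> mx i.
have -> : (fun w => affine AB (x w) i 0) =
    (fun w => \sum_j AB.1 i j * x w j 0 + AB.2 i 0).
  by apply/funext => w; rewrite !mxE.
apply: measurable_funD => //; apply: measurable_sum => j.
exact: measurable_funM.
Qed.

Lemma measurable_realization disp (T : measurableType disp) (h : seq nat) din
    (th : nn_params din h) (x : T -> 'cV[R]_din) :
    (forall j, measurable_fun [set: T] (fun w => x w j 0)) ->
  measurable_fun [set: T] (fun w => realization th (x w)).
Proof.
elim: h din th x => [|n h IH] din th x mx /=; first exact: measurable_affine_entry.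
apply: IH => i.
have -> : (fun w => map_mx swish (affine th.1 (x w)) i 0) =
    swish \o (fun w => affine th.1 (x w) i 0) by apply/funext => w; rewrite /= mxE.
by apply: measurableT_comp; [exact: measurable_swish | exact: measurable_affine_entry].
Qed.

Section Loss.
Context (a b : R) (hab : a < b) (d D : nat) (F : (d + D).-tuple R -> R).

Definition input_column (u : (d + D).-tuple R) : 'cV[R]_d := \col_j tnth (input a b u) j.

(** The loss of a network without the cut-off outside of the box, which the
    input meets with probability 0: unlike the loss of the truncated network,
    it is differentiable. *)
Definition loss (h : seq nat) (th : nn_params d h) (u : (d + D).-tuple R) : R :=
  (realization th (input_column u) - F u) ^+ 2.

Lemma input_columnE u j : input_column u j 0 = a + (b - a) * tnth u (lshift D j).
Proof. by rewrite mxE tnth_mktuple. Qed.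

(** The exponent [eta] is shared between the two factors of the square. *)
Lemma growth_loss (r eta : R) (h : seq nat) : 0 <= r -> 0 < eta ->
    boundary_growth_arbitrarily_small F ->
  exists2 A, 0 <= A & forall th : nn_params d h, nn_norm th <= r ->
    growth (@all_coords (d + D)) (fun=> eta) A (loss th).
Proof.
move=> r0 eta0 hF; have eta2 : 0 < eta / 2 by rewrite divr_gt0.
have [Bs Bd hB] := hF _ eta2.
have [B B0 growF] := growth_mixed_partial Bd hB.
have {}growF := growF _ (@sorted_all_coords (d + D)).
pose l := @all_coords (d + D).
have X0 : 0 <= `|a| + `|b - a| by rewrite addr_ge0.
have [N N0 growN] := @growth_realization R (d + D) l r r0 h d _ X0.
have p0 : 0 <= 2 ^+ size l :> R by rewrite exprn_ge0.
pose M := N + 2 ^+ size l * (`|-1| * B).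
have M0 : 0 <= M by rewrite addr_ge0 ?mulr_ge0.
exists (2 ^+ size l * (M * M)); first by rewrite !mulr_ge0.
move=> th hth.
have gN : growth l (fun=> eta / 2) N (fun u => realization th (input_column u)).
  have hx i : growth l (fun=> 0) (`|a| + `|b - a|) (fun u => input_column u i 0).
    have -> : (fun u => input_column u i 0) = (fun u => a + (b - a) * tnth u (lshift D i)).
      by apply/funext => u; exact: input_columnE.
    exact: growth_affine_coord.
  by apply: growth_le (growN th input_column hth hx) => [i|]; rewrite ?N0 ?lexx// ltW.
have gD : growth l (fun=> eta / 2) M (fun u => realization th (input_column u) - F u).
  have -> : (fun u => realization th (input_column u) - F u) =
      (fun u => realization th (input_column u) + (-1) * F u).
    by apply/funext => u; rewrite mulN1r.
  by apply: growthD => //; apply: growth_scale => // i; exact: ltW.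
have := growthM M0 M0 gD gD.
have -> : loss th = (fun u => (realization th (input_column u) - F u) *
    (realization th (input_column u) - F u)) by apply/funext => u; rewrite /loss expr2.
by apply: growth_le => [i|]; rewrite /= -?splitr// lexx !mulr_ge0.
Qed.

Lemma measurable_input_column j :
  measurable_fun [set: (d + D).-tuple R] (fun u => input_column u j 0).
Proof.
have -> : (fun u => input_column u j 0) = (fun u => a + (b - a) * tnth u (lshift D j)).
  by apply/funext => u; exact: input_columnE.
apply: measurable_funD => //; apply: measurable_funM => //; exact: measurable_tnth.
Qed.

Hypothesis mF : measurable_fun [set: (d + D).-tuple R] F.

Lemma measurable_loss h (th : nn_params d h) :
  measurable_fun [set: (d + D).-tuple R] (loss th).
Proof.
apply: measurable_funX; apply: measurable_funB => //.
by apply: measurable_realization; exact: measurable_input_column.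
Qed.

Lemma input_box (u : (d + D).-tuple R) : open_cube u -> box a b (input a b u).
Proof.
move=> cu j; rewrite tnth_mktuple; have /andP[u0 u1] := cu (lshift D j).
have ba : 0 < b - a by rewrite subr_gt0.
have h1 : 0 <= (b - a) * tnth u (lshift D j) by rewrite mulr_ge0// ltW.
have h2 : 0 <= (b - a) * (1 - tnth u (lshift D j)) by rewrite mulr_ge0 ?subr_ge0// ltW.
by apply/andP; split; lra.
Qed.

Definition network_fun h (th : nn_params d h) : d.-tuple R -> R :=
  (fun x : d.-tuple R => realization th (\col_j tnth x j)) \_ (box a b).

Lemma lossE h (th : nn_params d h) (u : (d + D).-tuple R) : open_cube u ->
  (network_fun th (input a b u) - F u) ^+ 2 = loss th u.
Proof. by move=> cu; rewrite /network_fun patchE mem_set//; exact: input_box. Qed.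

Lemma measurable_network_loss h (th : nn_params d h) :
  measurable_fun [set: (d + D).-tuple R]
    (fun u : (d + D).-tuple R => (network_fun th (input a b u) - F u) ^+ 2).
Proof.
apply: measurable_funX; apply: measurable_funB => //.
pose B : set ((d + D).-tuple R) := [set u | box a b (input a b u)].
have mB : measurable B.
  have -> : B = \bigcap_(j in [set: 'I_d])
      ((fun u => input_column u j 0) @^-1` `[a, b]%classic).
    apply/seteqP; split => u /=.
      by move=> h' j _; rewrite /= in_itv /= mxE; exact: h'.
    by move=> h' j; have := h' j I; rewrite /= in_itv /= mxE.
  apply: fin_bigcap_measurable => // j _; rewrite -[X in measurable X]setTI.
  by apply: measurable_input_column => //; exact: measurable_itv.
have -> : (fun u : (d + D).-tuple R => network_fun th (input a b u)) =
    (fun u => realization th (input_column u) * \1_B u).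
  apply/funext => u; rewrite /network_fun patchE indicE.
  have [uB|uB] := pselect (B u); first by rewrite !mem_set// mulr1.
  by rewrite !memNset// mulr0.
apply: measurable_funM; last exact: measurable_indic.
by apply: measurable_realization; exact: measurable_input_column.
Qed.

Lemma risk_network disp (T : measurableType disp) (P : probability T R)
    (U : {RV P >-> (d + D).-tuple R}) (base m : nat) h (th : nn_params d h) :
    (0 < base)%N -> uniform_on_cube U ->
  risk P a b F U (network_fun th) =
  (\int[cube_prob (d + D)]_(u in grid_free base m) (loss th u)%:E)%E.
Proof.
move=> base0 hU; have mL := measurable_network_loss th.
pose phi (u : (d + D).-tuple R) : \bar R := ((network_fun th (input a b u) - F u) ^+ 2)%:E.
have mphi : measurable_fun setT phi by apply/measurable_EFinP.
have phi0 u : (0 <= phi u)%E by rewrite lee_fin sqr_ge0.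
rewrite /risk unlock.
transitivity (\int[cube_prob (d + D)]_u phi u)%E.
  rewrite -(eq_measure_integral (cube_prob (d + D)) (m1 := distribution P U)).
    by rewrite ge0_integral_distribution.
  by move=> A mA _; exact: hU.
rewrite (integral_grid_free m base0 mphi phi0); apply: eq_integral => u.
by rewrite inE => /grid_free_open_cube cu; rewrite /phi lossE.
Qed.

Lemma empirical_risk_network (n : nat) (p : nat -> (d + D).-tuple R) h
    (th : nn_params d h) : (forall i : 'I_n, open_cube (p i)) ->
  empirical_risk a b F p n (network_fun th) = n%:R^-1 * \sum_(i < n) loss th (p i).
Proof.
by move=> cp; rewrite /empirical_risk; congr (_ * _); apply: eq_bigr => i _; rewrite lossE.
Qed.
End Loss.
End RiskOfNetworks.

(** * Rate of convergence *)

Section Rate.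
Context {R : realType}.

Lemma polynomial_le_exponential (s base : nat) (eps : R) : (2 <= base)%N -> 0 < eps ->
  exists2 K, 0 <= K & forall m : nat,
    (m.+2 ^ s)%:R <= K * ((base ^ m)%N)%:R `^ eps.
Proof.
move=> base2 eps0; have base1 : 1 < base%:R :> R by rewrite ltr1n.
(* [q ^ s.+1] is [base ^ eps]; the successor avoids a division by [0] *)
pose q : R := base%:R `^ (eps / s.+1%:R).
have e0 : 0 < eps / s.+1%:R by rewrite divr_gt0.
have q1 : 1 < q.
  rewrite /q -[ltLHS](powRr0 base%:R) /powR !gt_eqF ?(lt_trans ltr01 base1)//.
  by rewrite ltr_expR mul0r mulr_gt0// ln_gt0.
have q0 : 0 < q by exact: lt_trans ltr01 q1.
pose K1 := 2 + (q - 1)^-1.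
have q10 : 0 < q - 1 by rewrite subr_gt0.
have K10 : 0 <= K1 by rewrite addr_ge0// invr_ge0 ltW.
exists (K1 ^+ s); first by rewrite exprn_ge0.
move=> m.
have bernoulli : 1 + m%:R * (q - 1) <= q ^+ m.
  elim: m => [|m IH]; first by rewrite mul0r addr0 expr0.
  have m0 : 0 <= m%:R * (q - 1) by rewrite mulr_ge0// ltW.
  by rewrite exprS -natr1; nra.
have mq : m.+2%:R <= K1 * q ^+ m.
  have qm : m%:R <= (q - 1)^-1 * q ^+ m by rewrite -ler_pdivrMl ?invr_gt0// invrK mulrC; lra.
  have q1m : 1 <= q ^+ m by rewrite exprn_ege1// ltW.
  by rewrite -addn2 natrD /K1 mulrDl; lra.
apply: (@le_trans _ _ ((K1 * q ^+ m) ^+ s)).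
  by rewrite natrX lerXn2r// ?nnegrE// mulr_ge0// exprn_ge0// ltW.
have -> : ((base ^ m)%N%:R : R) `^ eps = (base%:R `^ eps) ^+ m.
  rewrite natrX -[in LHS]powR_mulrn ?ler0n// -powRrM mulrC powRrM.
  by rewrite powR_mulrn ?powR_ge0.
rewrite exprMn ler_wpM2l ?exprn_ge0// -exprM mulnC exprM.
apply: lerXn2r; rewrite ?nnegrE ?exprn_ge0 ?powR_ge0// ?(ltW q0)//.
apply: (@le_trans _ _ (q ^+ s.+1)); first by rewrite ler_weXn2l// ltW.
by rewrite /q -powR_mulrn ?powR_ge0// -powRrM divfK// lexx.
Qed.
End Rate.

Section UniformSamples.
Context {R : realType} disp (T : measurableType disp) (P : probability T R) (s : nat).
Local Open Scope ereal_scope.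

Lemma integral_uniform_sample (X : {RV P >-> s.-tuple R}) (W : s.-tuple R -> R) :
    uniform_on_cube X -> measurable_fun setT W -> (forall x, 0 <= W x)%R ->
  \int[P]_w (W (X w))%:E = \int[cube_prob s]_x (W x)%:E.
Proof.
move=> hX mW W0; rewrite -(eq_measure_integral (cube_prob s) (m1 := distribution P X)).
  by rewrite ge0_integral_distribution//; apply/measurable_EFinP.
by move=> A mA _; exact: hX.
Qed.

Lemma integral_uniform_samples (n : nat) (u : nat -> {RV P >-> s.-tuple R})
    (W : s.-tuple R -> R) (V c e : R) :
    (forall i, uniform_on_cube (u i)) -> measurable_fun setT W ->
    (forall x, 0 <= W x)%R -> (0 <= c)%R -> (0 <= e)%R ->
    \int[cube_prob s]_x (W x)%:E = V%:E ->
  \int[P]_w (c * \sum_(i < n) W (u i w) + e)%:E = (c * (n%:R * V) + e)%:E.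
Proof.
move=> hu mW W0 c0 e0 hV.
have mWu i : measurable_fun [set: T] (fun w => (W (u i w))%:E).
  by apply/measurable_EFinP; apply: measurableT_comp.
have intS : \int[P]_w (\sum_(i < n) W (u i w))%:E = (n%:R * V)%:E.
  have Wu0 (i : 'I_n) w : setT w -> 0 <= (W (u i w))%:E by rewrite lee_fin.
  under eq_integral do rewrite -sumEFin.
  rewrite (ge0_integral_sum _ measurableT (fun i : 'I_n => mWu i) Wu0).
  under eq_bigr do rewrite integral_uniform_sample// hV.
  by rewrite sumEFin sumr_const card_ord mulr_natl.
have mS : measurable_fun [set: T] (fun w => (\sum_(i < n) W (u i w))%:E).
  by apply/measurable_EFinP; apply: measurable_sum => i; apply: measurableT_comp.
have S0 w : 0 <= (\sum_(i < n) W (u i w))%:E by rewrite lee_fin; apply: sumr_ge0.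
under eq_integral do rewrite EFinD EFinM.
rewrite ge0_integralD//.
- by rewrite ge0_integralZl_EFin// intS integral_cst//= probability_setT mule1.
- by move=> w _; rewrite mule_ge0.
- by apply: emeasurable_funM.
Qed.
End UniformSamples.

Theorem theorem3p2
  (R : realType) (disp : measure_display) (T : measurableType disp)
  (P : probability T R)
  (a b : R) (hab : a < b)
  (d D : nat) (hd : (0 < d)%N) (hD : (0 < D)%N)
  (F : (d + D).-tuple R -> R)
  (hF : F \in Lfun (cube_prob (d + D)) 2%:E)
  (U : {RV P >-> (d + D).-tuple R}) (hU : uniform_on_cube U)
  (L : nat) (hL : (2 <= L)%N)
  (widths : L.-1.-tuple nat) (hwidths : forall l, (0 < tnth widths l)%N)
  (r : R) (hr : 0 < r)
  (u : nat -> {RV P >-> (d + D).-tuple R})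
  (hu : forall i, uniform_on_cube (u i))
  (fH : d.-tuple R -> R)
  (hfH : argmin (nn_class a b d widths r) (risk P a b F U) fH)
  (fn : nat -> T -> d.-tuple R -> R)
  (hfn : forall n w, (0 < n)%N ->
    argmin (nn_class a b d widths r)
      (empirical_risk a b F (fun i => u i w) n) (fn n w))
  (hfn_meas : forall n, (0 < n)%N ->
    measurable_fun [set: T] (fun w => risk P a b F U (fn n w)))
  (hBGC : boundary_growth_arbitrarily_small F)
  (beta t : nat) (hbeta : (2 <= beta)%N)
  (hscr : scrambled_ts_sequence P (ltnW hbeta) t (fun i => u i : T -> _)) :
  forall eps : R, 0 < eps ->
    exists C : R, \forall m \near \oo,
      (`| \int[P]_w (risk P a b F U (fn (beta ^ m)%N w) - risk P a b F U fH) |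
         <= (C * ((beta ^ m)%N)%:R `^ (-1 + eps))%:E)%E.
Proof.
move=> eps eps0.
have beta0 : (0 < beta)%N by exact: ltnW.
have mF : measurable_fun [set: (d + D).-tuple R] F.
  by move: hF; rewrite inE => /andP[]; rewrite inE.
(* the boundary growth costs [2 * eta <= eps / 2] in the exponent, and the number
   of increments is absorbed by the other half of [eps] *)
pose eta : R := Num.min (eps / 4) (1 / 4).
have eta0 : 0 < eta by rewrite lt_min !divr_gt0.
have eta_eps : 2 * eta <= eps / 2.
  have : eta <= eps / 4 by rewrite ge_min lexx.
  lra.
have eta_1 : 2 * eta <= 1.
  have : eta <= 1 / 4 by rewrite ge_min lexx orbT.
  lra.
have j0 : 'I_(d + D) by exact: (lshift D (Ordinal hd)).
have [A A0 hA] := growth_loss a b widths (ltW hr) eta0 hBGC.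
have [V V0 hV] := @integral_integrable_weight R (d + D) eta ltac:(lra).
have [K K0 hK] := @polynomial_le_exponential R (d + D) beta (eps / 2) hbeta ltac:(lra).
have [pts [pts_net [pi [_ _ _ scr]]]] := hscr.
pose C0 : R := node_const beta ^+ (d + D).
have C00 : 0 <= C0.
  rewrite exprn_ge0//; have := @node_const_ge2 R beta hbeta; lra.
have dec0 : 0 < decay beta eta :> R by exact: decay_gt0.
(* two deviations, of [fn] and of [fH]; the mean of each is at most [2 * Lam * V],
   one [V] for the average over the points and one for the integral *)
exists (4 * V * (K * (A * C0) / decay beta eta ^+ t)).
near=> m.
have tm : (t <= m)%N by near: m; exact: nbhs_infty_ge.
pose n := (beta ^ m)%N; have n0 : (0 < n)%N by rewrite expn_gt0 beta0.
have [Lam LamE] : exists Lam : R, Lam = error_factor (s := d + D) beta t m A eta.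
  by eexists.
have Lam0 : 0 <= Lam.
  by rewrite LamE !mulr_ge0// exprn_ge0// ltW.
pose W := @integrable_weight R (d + D) eta.
pose avgW w : R := n%:R^-1 * \sum_(i < n) W (u i w).
pose good w := forall i : 'I_n, grid_free beta m (u i w).
have deviation f : nn_class a b d widths r f ->
    exists2 I, risk P a b F U f = I%:E & forall w, good w ->
      `|empirical_risk a b F (fun i => u i w) n f - I| <= Lam * (avgW w + V).
  move=> [th hth <-].
  have mL : measurable_fun [set: (d + D).-tuple R] (loss a b F th) by exact: measurable_loss.
  have [I hI dev] := sampling_error hbeta tm j0 eta0 eta_1 A0 hV mL (hA th hth).
  exists I; first by rewrite -hI; exact: risk_network.
  move=> w gw.
  have cw (i : 'I_n) : open_cube (u i w) by exact/grid_free_open_cube/gw.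
  have -> := @empirical_risk_network R a b hab d D F n (fun i => u i w) _ th cw.
  rewrite LamE; apply: (dev (fun i => u i w)) => //.
  by apply: (net_counts_scrambling (scr w)); [exact: (pts_net 0%N m tm) | exact: gw].
have [HfH fH_min] := hfH.
have [IH hIH devH] := deviation fH HfH.
have excess_ge0 w : (0 <= risk P a b F U (fn n w) - risk P a b F U fH)%E.
  have [Hfn _] := hfn n w n0; have [In hIn _] := deviation _ Hfn.
  by have := fH_min _ Hfn; rewrite hIn hIH -EFinB !lee_fin subr_ge0.
have excess_le w : good w ->
    (risk P a b F U (fn n w) - risk P a b F U fH <=
     ((2 * Lam / n%:R) * \sum_(i < n) W (u i w) + 2 * Lam * V)%:E)%E.
  move=> gw; have [Hfn fn_min] := hfn n w n0.
  have [In hIn devn] := deviation _ Hfn.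
  rewrite hIn hIH -EFinB lee_fin.
  have e1 : empirical_risk a b F (fun i => u i w) n (fn n w) <=
            empirical_risk a b F (fun i => u i w) n fH by exact: fn_min.
  have -> : (2 * Lam / n%:R) * \sum_(i < n) W (u i w) + 2 * Lam * V = 2 * (Lam * (avgW w + V)).
    by rewrite /avgW; ring.
  move: (devn w gw) (devH w gw) e1; rewrite !ler_norml.
  set B := Lam * _; set x := empirical_risk _ _ _ _ _ _; set y := empirical_risk _ _ _ _ _ _.
  by move=> /andP[e2 e3] /andP[e4 e5] e1; lra.
have good_ae : \forall w \ae P, good w.
  apply: filter_forall => i; exists (u i @^-1` (~` grid_free beta m)); split.
  - by apply: measurable_funPTI => //; apply: measurableC; exact: measurable_grid_free.
  - have := hu i (~` grid_free beta m) (measurableC (measurable_grid_free _ _)).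
    by rewrite cube_prob_grid_freeC.
  - by move=> w h1 h2; apply: h1.
have int_le : (\int[P]_w (risk P a b F U (fn n w) - risk P a b F U fH) <=
    (4 * Lam * V)%:E)%E.
  have cst0 : 0 <= 2 * Lam / n%:R by rewrite !mulr_ge0 ?invr_ge0.
  have cst1 : 0 <= 2 * Lam * V by rewrite !mulr_ge0.
  have W0 := @integrable_weight_ge0 R (d + D) eta.
  have mW := @measurable_integrable_weight R (d + D) eta.
  have nn0 : n%:R != 0 :> R by rewrite pnatr_eq0 -lt0n.
  have <- : (\int[P]_w ((2 * Lam / n%:R) * \sum_(i < n) W (u i w) + 2 * Lam * V)%:E =
      (4 * Lam * V)%:E)%E.
    rewrite (integral_uniform_samples n hu mW W0 cst0 cst1 hV).
    by congr EFin; field.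
  apply: ae_ge0_le_integral => //.
  - apply: emeasurable_funB => //; exact: hfn_meas.
  - move=> w _; rewrite lee_fin addr_ge0// mulr_ge0//; apply: sumr_ge0 => i _; exact: W0.
  - apply/measurable_EFinP; apply: measurable_funD => //; apply: measurable_funM => //.
    by apply: measurable_sum => i; apply: measurableT_comp.
  - by apply: filterS good_ae => w gw _; exact: excess_le.
rewrite gee0_abs; last by apply: integral_ge0 => w _.
apply: (le_trans int_le); rewrite lee_fin.
have nR0 : 0 < n%:R :> R by rewrite ltr0n.
have n1 : 1 <= n%:R :> R by rewrite ler1n.
have decay_m : decay beta eta ^+ m = n%:R `^ (- (1 - 2 * eta)) by rewrite decayX natrX.
have rate : n%:R `^ (eps / 2) * decay beta eta ^+ m <= n%:R `^ (-1 + eps).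
  rewrite decay_m -powRD; last by rewrite (gt_eqF nR0) implybT.
  by apply: ler_powR => //; lra.
have dect : decay beta eta ^+ (m - t) = decay beta eta ^+ m / decay beta eta ^+ t.
  by rewrite -[in RHS](subnK tm) exprD mulfK// gt_eqF// exprn_gt0.
have AC0 : 0 <= A * C0 by rewrite mulr_ge0.
have dm0 : 0 <= decay beta eta ^+ m :> R by rewrite exprn_ge0// ltW.
have dt0 : 0 <= (decay beta eta ^+ t)^-1 :> R by rewrite invr_ge0 exprn_ge0// ltW.
have Lam_le : Lam <= K * (A * C0) / decay beta eta ^+ t * n%:R `^ (-1 + eps).
  rewrite LamE /error_factor dect.
  apply: (@le_trans _ _ (K * n%:R `^ (eps / 2) *
      (A * C0 * (decay beta eta ^+ m / decay beta eta ^+ t)))).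
    apply: ler_wpM2r; last exact: hK.
    by rewrite mulr_ge0// mulr_ge0.
  rewrite (_ : _ * _ = K * (A * C0) / decay beta eta ^+ t *
     (n%:R `^ (eps / 2) * decay beta eta ^+ m)); last by ring.
  by apply: ler_wpM2l => //; rewrite mulr_ge0// mulr_ge0.
have := ler_wpM2l (mulr_ge0 (ler0n R 4) V0) Lam_le.
by rewrite -/n; lra.
Unshelve. all: by end_near. Qed.
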